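(* For any $k,\ell\ge1$, $\lambda\in\mathrm{Par}^k_\ell$ and $m\in[\ell]$, $$H(\Delta^k(\lambda);\lambda-\epsilon_m)=\sum_{T\in\mathrm{VSMT}^k_{(1)}(\lambda),\ \mathrm{marks}(T)=\{m\}}t^{\mathrm{spin}(T)}\,\mathfrak s^{(k)}_{\mathrm{inside}(T)}.$$
   Context: $[n]=\{1,\dots,n\}$; $\epsilon_i\in\mathbb Z^\ell$ standard basis vectors. For $\gamma\in\mathbb Z^\ell$, $s_\gamma=\det(h_{\gamma_i+j-i})_{1\le i,j\le\ell}$. $\Delta^+_\ell=\{(i,j):1\le i<j\le\ell\}$. For $\Psi\subset\Delta^+_\ell$ and $\gamma\in\mathbb Z^\ell$, $H(\Psi;\gamma)$ is obtained by expanding $\prod_{(i,j)\in\Psi}(1-tz_i/z_j)^{-1}z^\gamma$ as a power series in $t$ and applying coefficientwise the linear map $z^\beta\mapsto s_\beta$. $\mathrm{Par}^k_\ell=\{\mu\in\mathbb Z^\ell:k\ge\mu_1\ge\dots\ge\mu_\ell\ge0\}$, $\mathrm{Par}^k$ the partitions with largest part $\le k$ (identified with their zero-paddings). $\Delta^k(\mu)=\{(i,j)\in\Delta^+_\ell:k-\mu_i+i<j\}$, $\mathfrak s^{(k)}_\mu=H(\Delta^k(\mu);\mu)$. Hook length (English notation): boxes below in the column plus those weakly right in the row. A $(k+1)$-core is a partition with no box of hook length $k+1$; $\mathfrak p(\kappa)$ has $r$-th part the number of boxes in row $r$ of $\kappa$ with hook length $\le k$ (a bijection from $(k+1)$-cores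 to $\mathrm{Par}^k$). A strong cover $\tau\Rightarrow\kappa$: $(k+1)$-cores, $\tau\subset\kappa$, $|\mathfrak p(\tau)|+1=|\mathfrak p(\kappa)|$; a strong marked cover $\tau\xRightarrow{r}\kappa$ adds a positive integer $r$ equal to the smallest row index of some connected component of $\kappa/\tau$; its spin is $c(h-1)+N$ with $c$ the number of components, $h$ the common height of each component, $N$ the number of components entirely in rows $>r$. $\mathrm{VSMT}^k_{(1)}(\lambda)$ is the set of strong marked covers $T=(\tau\xRightarrow{r}\kappa)$ with $\mathfrak p(\kappa)=\lambda$; $\mathrm{inside}(T)=\mathfrak p(\tau)$, $\mathrm{marks}(T)=\{r\}$, $\mathrm{spin}(T)$ its spin. *)

(* Defs.v *)
From HB Require Import structures.
From mathcomp Require Import all_boot all_order all_algebra finmap.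
From mathcomp.multinomials Require Import monalg.

Set Implicit Arguments.
Unset Strict Implicit.
Unset Printing Implicit Defensive.

Import GRing.Theory.
Local Open Scope ring_scope.

(* Rows, columns and coordinates are numbered from 0: the ordinal (m : 'I_ell)
   stands for the (m+1)-st element of {1, ..., ell}, and likewise for the mark
   of a strong marked cover. *)

(** * The ring of symmetric functions and Catalan functions *)

(* Lambda = Z[h_1, h_2, ...], the free commutative ring on the complete
   homogeneous symmetric functions; the variable of index n is h_(n+1). *)
Definition Lambda : Type := {malg int[{cmonom nat}]}.
HB.instance Definition _ := GRing.ComNzRing.on Lambda.

Definition hsym (n : int) : Lambda :=
  match n with
  | Posz 0 => 1
  | Posz n.+1 => << ucm n >>
  | Negz _ => 0
  end.

Definition schur (ell : nat) (g : 'rV[int]_ell) : Lambda :=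
  \det (\matrix_(i < ell, j < ell) hsym (g 0 i + j%:Z - i%:Z)).

Definition eps (ell : nat) (i : 'I_ell) : 'rV[int]_ell := delta_mx 0 i.

(* Formal power series in t over Lambda: (f d) is the coefficient of t^d. *)
Definition tseries := nat -> Lambda.

Definition tpow_mul (s : nat) (f : tseries) : tseries :=
  fun d => if (s <= d)%N then f (d - s)%N else 0.

Definition posroots (ell : nat) : {set 'I_ell * 'I_ell} :=
  [set a : 'I_ell * 'I_ell | (a.1 < a.2)%N].

(* The coefficient of t^d in the product over (i, j) in Psi of
   1 / (1 - t z_i / z_j) = sum_n t^n (z_i / z_j)^n, times z^g, is the sum of
   z^(g + sum_(i,j) n_ij (eps_i - eps_j)) over the families of exponents n
   supported on Psi and of total d; each z^b is then sent to s_b. *)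
Definition catalan (ell : nat) (Psi : {set 'I_ell * 'I_ell})
    (g : 'rV[int]_ell) : tseries :=
  fun d =>
    \sum_(n : {ffun 'I_ell * 'I_ell -> 'I_d.+1} |
          [forall a, (a \notin Psi) ==> (n a == 0%N :> nat)]
          && (\sum_a n a == d)%N)
      schur (g + \sum_a (eps a.1 - eps a.2) *+ n a).

Definition Delta (k ell : nat) (mu : 'rV[int]_ell) : {set 'I_ell * 'I_ell} :=
  [set a in posroots ell | k%:Z - mu 0 a.1 + a.1%:Z < a.2%:Z].

(* Membership in Par^k_ell. *)
Definition in_Par (k ell : nat) (mu : 'rV[int]_ell) : Prop :=
  (forall i, 0 <= mu 0 i <= k%:Z) /\
  (forall i j : 'I_ell, (i <= j)%N -> mu 0 j <= mu 0 i).

(* Here ell is the length of the list; trailing zeros do not change the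
   resulting symmetric function when mu is a k-bounded partition. *)
Definition kschur (k : nat) (mu : seq nat) : tseries :=
  let v := \row_(i < size mu) (nth 0%N mu i)%:Z in
  catalan (Delta k v) v.

(* The list mu and the vector lam agree up to padding by zeros. *)
Definition same_padding (ell : nat) (mu : seq nat) (lam : 'rV[int]_ell) : Prop :=
  forall r : nat,
    (nth 0%N mu r)%:Z = (if insub r is Some i then lam 0 i else 0).

(** * Cores and strong marked covers *)

Local Open Scope nat_scope.

Definition is_partition (s : seq nat) : bool := sorted geq s && (0 \notin s).

(* Hook length of the box in row r, column c, for c < nth 0 s r. *)
Definition hook (s : seq nat) (r c : nat) : nat :=
  (nth 0 s r - c) + count (fun p => c < p) (drop r.+1 s).

Definition is_core (k : nat) (s : seq nat) : Prop :=
  is_partition s /\ forall r c, c < nth 0 s r -> hook s r c <> k.+1.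

(* The map p from (k+1)-cores to k-bounded partitions. *)
Definition core_part (k : nat) (s : seq nat) : seq nat :=
  [seq count (fun c => hook s r c <= k) (iota 0 (nth 0 s r))
  | r <- iota 0 (size s)].

Definition strong_cover (k : nat) (tau kappa : seq nat) : Prop :=
  [/\ is_core k tau, is_core k kappa,
      forall r, nth 0 tau r <= nth 0 kappa r
    & sumn (core_part k tau) + 1 = sumn (core_part k kappa)].

Section SkewShape.

Variables tau kappa : seq nat.

(* A finite grid containing every box (row, column) of the partition kappa. *)
Local Notation box := ('I_(size kappa) * 'I_(head 0 kappa))%type.

Definition skew_boxes : {set box} :=
  [set b : box | nth 0 tau b.1 <= b.2 < nth 0 kappa b.1].

Definition edge_adjacent (a b : box) : bool :=
  ((a.1 == b.1) && ((a.2.+1 == b.2 :> nat) || (b.2.+1 == a.2 :> nat))) ||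
  ((a.2 == b.2) && ((a.1.+1 == b.1 :> nat) || (b.1.+1 == a.1 :> nat))).

Definition skew_connected : rel box :=
  connect (fun a b => [&& a \in skew_boxes, b \in skew_boxes & edge_adjacent a b]).

Definition components : {set {set box}} :=
  equivalence_partition skew_connected skew_boxes.

Definition rows_of (C : {set box}) : {set 'I_(size kappa)} :=
  [set b.1 | b in C].

Definition height (C : {set box}) : nat := #|rows_of C|.

(* All components of a strong cover have the same height, so that the maximum
   is this common height. *)
Definition common_height : nat := \max_(C in components) height C.

Definition is_top_row (r : nat) (C : {set box}) : bool :=
  [exists i in rows_of C, i == r :> nat] && [forall i in rows_of C, r <= i].

Definition cover_spin (r : nat) : nat :=
  #|components| * (common_height - 1)
  + #|[set C in components | [forall i in rows_of C, r < i]]|.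

End SkewShape.

(* The triple (tau, kappa, r). *)
Notation marked_pair := (seq nat * seq nat * nat)%type.

Definition smc_inner (T : marked_pair) : seq nat := T.1.1.
Definition smc_outer (T : marked_pair) : seq nat := T.1.2.
Definition smc_mark (T : marked_pair) : nat := T.2.

Definition strong_marked_cover (k : nat) (T : marked_pair) : Prop :=
  strong_cover k (smc_inner T) (smc_outer T) /\
  exists2 C, C \in components (smc_inner T) (smc_outer T)
           & is_top_row (smc_mark T) C.

(* Membership in VSMT^k_(1)(lam). *)
Definition in_VSMT1 (k ell : nat) (lam : 'rV[int]_ell) (T : marked_pair) : Prop :=
  strong_marked_cover k T /\ same_padding (core_part k (smc_outer T)) lam.

Definition inside (k : nat) (T : marked_pair) : seq nat :=
  core_part k (smc_inner T).

Definition marks (T : marked_pair) : {fset nat} := [fset smc_mark T]%fset.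

Definition spin (T : marked_pair) : nat :=
  cover_spin (smc_inner T) (smc_outer T) (smc_mark T).

(* Main.v *)
(** Write n = k+1 and record a core by its beads b_r = kappa_r - r. The bead
    b_r - n belongs to the row d(r) = r + n - lambda_r, so the rows starting the
    columns of Delta^k(lambda) trace the runners of the abacus.

    On the algebraic side let S(g) = H(Delta^k(g); g) for any integer weight g with
    parts at most k. Removing one root gives
    H(Delta^k(lambda); lambda - e_m) = S(lambda - e_m) + t H(Delta^k(lambda); lambda - e_d(m)),
    so the left hand side is a sum of t^i S(lambda - e_z) over z = d^i(m). If
    g_(x+1) = g_x + 1, antisymmetry of Schur functions shows that S(g) vanishes when
    no row w starts at column x+1, and equals t S(g + e_w - e_(x+1)) when exactly one
    does. Repeating this turns S(lambda - e_z) into 0 or into a power of t times S of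
    an explicit partition.

    On the combinatorial side that partition belongs to the core obtained by sliding
    the bead of row z, and all beads above it on its runner, down past the same number
    of beads. All strong covers arise in this way, because whenever a core tau is
    strictly contained in kappa some such slide of kappa still contains tau; it is
    found by comparing, for each position x, how many beads of tau and of kappa lie at
    positions at least x. *)
Require Import Defs.
From Stdlib Require Import Classical_Prop.
From mathcomp Require Import all_boot all_order all_fingroup all_algebra finmap zify ring.
From mathcomp.multinomials Require Import monalg.

Set Implicit Arguments.
Unset Strict Implicit.
Unset Printing Implicit Defensive.

Import Order.TTheory GRing.Theory Num.Theory.
Local Open Scope ring_scope.

(** * Catalan functions *)

(** The height h of a slide is the number of consecutive rows, from z = d^a(T) on, whose part equals
    lambda_z. It is built up unit by unit. Height 1 is the weight lambda - e_z itself; to raise the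
    height, a unit is carried up the runner through a+1 rows, each time by one use of antisymmetry
    and at the cost of one factor t. Hence the power t^((a+1)(h-1)), the term c(h-1) of the spin for
    c = a+1 components of height h. The i steps from m to z = d^i(m) give the other term N = i. The
    walk fails exactly when no slide with last row z exists.

    The weights met on the way are not partitions, which is why Catalan functions are handled for
    all integer weights with parts at most k.

    For the covers no length function is needed. A slide lowers |p| by exactly one and yields a
    core; since a slide always fits between two distinct nested cores, |p| is strictly monotone
    under inclusion, and a strong cover has to coincide with the slide that fits inside it. *)

Definition bounded_catalan (N ell : nat) (Psi : {set 'I_ell * 'I_ell})
    (g : 'rV[int]_ell) (d : nat) : Lambda :=
  \sum_(n : {ffun 'I_ell * 'I_ell -> 'I_N.+1} |
        [forall a, (a \notin Psi) ==> (n a == 0%N :> nat)]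
        && (\sum_a n a == d)%N)
    schur (g + \sum_a (eps a.1 - eps a.2) *+ n a).

Lemma leq_sum_term (I : finType) (F : I -> nat) (i : I) : (F i <= \sum_j F j)%N.
Proof. by rewrite (bigD1 i) //= leq_addr. Qed.

(** The index type of [catalan] depends on the degree; a common bound on the exponents lets
    coefficients of different degrees be compared by reindexing. *)
Lemma catalan_bounded N ell (Psi : {set 'I_ell * 'I_ell}) g d :
  (d <= N)%N -> catalan Psi g d = bounded_catalan N Psi g d.
Proof.
move=> leN; rewrite /bounded_catalan /catalan.
pose f (n : {ffun 'I_ell * 'I_ell -> 'I_d.+1}) : {ffun 'I_ell * 'I_ell -> 'I_N.+1} :=
  [ffun a => inord (n a)].
pose f' (n : {ffun 'I_ell * 'I_ell -> 'I_N.+1}) : {ffun 'I_ell * 'I_ell -> 'I_d.+1} :=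
  [ffun a => inord (n a)].
have fE n a : f n a = n a :> nat by rewrite ffunE inordK // ltnS; have := ltn_ord (n a); lia.
rewrite [RHS](reindex_onto f f') /=; last first.
  move=> n /andP[_ /eqP sn]; apply/ffunP=> a; apply: val_inj.
  rewrite /= fE ffunE inordK // ltnS -sn; exact: leq_sum_term.
apply: eq_big => [n|n _].
  have -> : f' (f n) == n.
    apply/eqP/ffunP=> a; apply: val_inj; rewrite /= ffunE inordK ?fE //.
  rewrite andbT; congr andb; first by apply: eq_forallb => a; rewrite fE.
  by under [X in _ = (X == _)]eq_bigr do rewrite fE.
by congr schur; congr (_ + _); apply: eq_bigr => a _; rewrite fE.
Qed.

(** This is 1/(1-u) = 1 + u/(1-u) for the factor of the root a: families with exponent 0 at a give
    the first term, the others lose one unit at a. *)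
Lemma catalan_remove ell (Psi : {set 'I_ell * 'I_ell}) g a d : a \in Psi ->
  catalan Psi g d = catalan (Psi :\ a) g d
    + (if d is d'.+1 then catalan Psi (g + (eps a.1 - eps a.2)) d' else 0).
Proof.
move=> aP.
have leN : (d <= d.+1)%N by [].
rewrite (catalan_bounded _ _ leN) (catalan_bounded (Psi :\ a) _ leN).
rewrite /bounded_catalan (bigID (fun n : {ffun _ -> 'I_d.+2} => n a == 0%N :> nat)) /=.
congr (_ + _).
  apply: eq_bigl => n; rewrite andbAC; congr andb.
  apply/andP/forallP => [[/forallP H na] b|H].
    by rewrite !inE negb_and negbK; case: eqVneq => [->|_] //=; apply: H.
  split; last by have := H a; rewrite !inE eqxx.
  by apply/forallP=> b; apply/implyP=> bP; apply: (implyP (H b)); rewrite !inE (negPf bP) andbF.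
case: d leN => [|d] _ /=.
  apply: big1 => n /andP[/andP[_ /eqP s0] /negP[]].
  by have := leq_sum_term (fun b => n b : nat) a; rewrite s0 leqn0.
have leN : (d <= d.+2)%N by lia.
rewrite (catalan_bounded _ _ leN) /bounded_catalan.
pose f (n : {ffun 'I_ell * 'I_ell -> 'I_d.+3}) : {ffun 'I_ell * 'I_ell -> 'I_d.+3} :=
  [ffun b => inord (n b + (b == a))].
pose f' (n : {ffun 'I_ell * 'I_ell -> 'I_d.+3}) : {ffun 'I_ell * 'I_ell -> 'I_d.+3} :=
  [ffun b => inord (n b - (b == a))].
have f'E n b : f' n b = (n b - (b == a))%N :> nat.
  by rewrite ffunE inordK //; have := ltn_ord (n b); lia.
rewrite [LHS](reindex_onto f f'); last first.
  move=> n /andP[/andP[_ /eqP sn] na]; apply/ffunP=> b; apply: val_inj.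
  have nb : (n b - (b == a) + (b == a) = n b)%N.
    case: eqVneq => [->|_]; last by rewrite subn0 addn0.
    by apply: subnK; rewrite lt0n.
  by rewrite /= ffunE f'E inordK nb.
have key (n : {ffun 'I_ell * 'I_ell -> 'I_d.+3}) : (\sum_b n b <= d.+1)%N ->
    forall b, f n b = (n b + (b == a))%N :> nat.
  move=> sn b; rewrite ffunE inordK //.
  by have := leq_sum_term (fun b => n b : nat) b; lia.
have keysum (n : {ffun 'I_ell * 'I_ell -> 'I_d.+3}) : (\sum_b n b <= d.+1)%N ->
    (\sum_b f n b = (\sum_b n b).+1)%N.
  move=> sn; rewrite (eq_bigr _ (fun b _ => key n sn b)) big_split /=.
  by rewrite -big_mkcond /= big_pred1_eq addn1.
apply: eq_big => [n|n /andP[/andP[/andP[_ /eqP sn] fa] /eqP f'n]].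
  (* Large sums are treated apart because [inord] overflows when the exponent at a is already
     d+2. *)
  have [sn|sn] := leqP (\sum_b n b)%N d.+1; last first.
    have -> : (\sum_b n b == d)%N = false by lia.
    rewrite andbF; apply/negP => /andP[/andP[/andP[_ /eqP sfn] fna] /eqP f'n].
    have : (\sum_b n b <= \sum_b f n b)%N.
      by apply: leq_sum => b _; rewrite -{1}f'n f'E leq_subr.
    by rewrite sfn leqNgt sn.
  rewrite keysum // eqSS key // eqxx addn1 andbT.
  have -> : f' (f n) == n.
    by apply/eqP/ffunP=> b; apply: val_inj; rewrite /= f'E key // addnK.
  rewrite andbT; congr andb; apply: eq_forallb => b.
  rewrite key //; case: (eqVneq b a) => [->|_]; first by rewrite aP.
  by rewrite addn0.
have sn' : (\sum_b n b <= d.+1)%N.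
  apply: leq_trans (eq_leq sn).
  by apply: leq_sum => b _; rewrite -{1}f'n f'E leq_subr.
congr schur; rewrite -addrA; congr (_ + _).
rewrite (eq_bigr (fun b => (eps b.1 - eps b.2) *+ n b + (eps b.1 - eps b.2) *+ (b == a))).
  rewrite big_split /= addrC; congr (_ + _).
  rewrite (bigD1 a) //= eqxx mulr1n big1 ?addr0 // => b /negPf->.
  by rewrite mulr0n.
by move=> b _; rewrite key // mulrnDr.
Qed.

Lemma catalan0 ell (g : 'rV[int]_ell) d :
  catalan set0 g d = if d == 0%N then schur g else 0.
Proof.
rewrite /catalan; case: eqVneq => [->|d0]; last first.
  apply: big1 => n /andP[/forallP H /eqP sn]; case/negP: d0.
  rewrite -sn sum_nat_eq0; apply/forallP=> a /=; by have := H a; rewrite inE.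
rewrite (big_pred1 [ffun=> ord0]) => [|n].
  by rewrite big1 ?addr0 // => a _; rewrite ffunE mulr0n.
apply/idP/eqP => [_|->].
  by apply/ffunP=> a; rewrite ffunE; apply: val_inj; case: (n a) => [[|]].
apply/andP; split; first by apply/forallP=> a; rewrite ffunE implybT.
by rewrite big1 // => a _; rewrite ffunE.
Qed.

(** Both terms of [catalan_remove] have a smaller value of |Psi| + d, so identities between Catalan
    functions reduce to identities between Schur functions. *)
Lemma catalan_ind ell
    (P : {set 'I_ell * 'I_ell} -> 'rV[int]_ell -> nat -> Prop) :
  (forall g d, P set0 g d) ->
  (forall (Psi : {set 'I_ell * 'I_ell}) g d a, a \in Psi -> P (Psi :\ a) g d ->
     (forall d', d = d'.+1 -> P Psi (g + (eps a.1 - eps a.2)) d') -> P Psi g d) ->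
  forall Psi g d, P Psi g d.
Proof.
move=> P0 P1 Psi g d; have [m] := ubnP (#|Psi| + d)%N.
elim: m Psi g d => // m IH Psi g d; rewrite ltnS => le.
have [->|[a aP]] := set_0Vmem Psi; first exact: P0.
apply: (P1 _ _ _ a aP) => [|d' dE]; apply: IH; last lia.
by have := cardsD1 a Psi; rewrite aP; lia.
Qed.

Lemma Lambda_eqN0 (x : Lambda) : x = - x -> x = 0.
Proof.
move=> xN; apply/malgP=> c; have := congr1 (fun y : {malg int[{cmonom nat}]} => mcoeff c y) xN.
rewrite /= mcoeffN mcoeff0; lia.
Qed.

(** * Antisymmetry of Catalan functions *)

Section DotAction.

Variables (ell : nat) (x x' : 'I_ell).
Hypothesis x'E : x' = x.+1 :> nat.

(** The dot action of a simple transposition, s(g + rho) - rho with rho = (ell-1, ..., 0); it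
    exchanges two rows of the Jacobi-Trudi matrix. *)
Definition dot_swap (g : 'rV[int]_ell) : 'rV[int]_ell :=
  col_perm (tperm x x') g - eps x + eps x'.

Lemma schur_dot g : schur (dot_swap g) = - schur g.
Proof.
rewrite /schur; set M := (X in - \det X).
have -> : (\matrix_(i < ell, j < ell) hsym (dot_swap g 0 i + j%:Z - i%:Z))
          = row_perm (tperm x x') M.
  apply/matrixP=> i j; rewrite !mxE /=; congr hsym.
  case: tpermP => [->|->|/eqP/negPf ne1 /eqP/negPf ne2].
  - by rewrite eqxx; case: eqP => [e|_]; [move: x'E; rewrite -e; lia | rewrite /=; lia].
  - by rewrite eqxx; case: eqP => [e|_]; [move: x'E; rewrite -e; lia | rewrite /=; lia].
  by rewrite ne1 ne2 /=; lia.
rewrite row_permE det_mulmx det_perm odd_tperm.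
have -> : x != x' by apply/eqP=> e; move: x'E; rewrite -e; lia.
by rewrite expr1 mulN1r.
Qed.

Definition swap_roots (Psi : {set 'I_ell * 'I_ell}) : {set 'I_ell * 'I_ell} :=
  [set a | (tperm x x' a.1, tperm x x' a.2) \in Psi].

(** Swapping roots and weight together commutes with the removal of a root. The swapped set may
    leave the positive roots, which [catalan] allows. *)
Lemma catalan_dot Psi g d :
  catalan (swap_roots Psi) (dot_swap g) d = - catalan Psi g d.
Proof.
move: Psi g d; apply: catalan_ind => [g d|Psi g d [i j] aP IH1 IH2].
  have -> : swap_roots set0 = set0 by apply/setP=> a; rewrite !inE.
  rewrite !catalan0 schur_dot; by case: ifP => // _; rewrite oppr0.
pose b := (tperm x x' i, tperm x x' j).
have bP : b \in swap_roots Psi by rewrite inE /= !tpermK.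
rewrite (catalan_remove _ _ bP) (catalan_remove _ _ aP) opprD -IH1; congr (_ + _).
  congr catalan; apply/setP=> -[u v]; rewrite !inE /=; congr (~~ _ && _).
  by rewrite !xpair_eqE !(canF_eq (tpermK x x')).
case: d IH1 IH2 => [|d] _ IH2; first by rewrite oppr0.
have -> : dot_swap g + (eps b.1 - eps b.2) = dot_swap (g + (eps i - eps j)).
  apply/rowP=> r; rewrite !mxE /=.
  have e u : (tperm x x' r == u) = (r == tperm x x' u) := can2_eq (tpermK x x') (tpermK x x') r u.
  by rewrite !e; ring.
exact: (IH2 _ erefl).
Qed.

(** The dot action fixes such a weight, so each coefficient is its own negative, and [Lambda] has no
    2-torsion. *)
Lemma catalan_dot_fixed (Psi : {set 'I_ell * 'I_ell}) (g : 'rV[int]_ell) d :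
  swap_roots Psi = Psi -> g 0 x' = g 0 x + 1 -> catalan Psi g d = 0.
Proof.
move=> sP gx; have dg : dot_swap g = g.
  apply/rowP=> r; rewrite !mxE /=.
  have xx' : (x == x') = false by apply/eqP=> e; move: x'E; rewrite -e; lia.
  case: tpermP => [->|->|/eqP/negPf-> /eqP/negPf->];
    rewrite ?eqxx ?xx' ?(eq_sym x') ?xx' /=; lia.
have := catalan_dot Psi g d; rewrite sP dg; exact: Lambda_eqN0.
Qed.

End DotAction.

(* A nonzero term of the determinant needs g_i + s(i) - i >= 0 for all i, while s
   cannot increase the sum of the indices i >= z. *)
Lemma schur_tail_neg ell (g : 'rV[int]_ell) (z : nat) :
  \sum_(i < ell | (z <= i)%N) g 0 i < 0 -> schur g = 0.
Proof.
move=> neg; rewrite /schur /determinant big1 // => s _.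
have [/forallP H|] := boolP [forall i : 'I_ell, 0 <= g 0 i + (s i)%:Z - i%:Z]; last first.
  rewrite negb_forall => /existsP[i]; rewrite -ltNge => lt0.
  rewrite (bigD1 i) //= mxE; case: (_ - _) lt0 => // m _ /=.
  by rewrite mul0r mulr0.
have : 0 <= \sum_(i < ell | (z <= i)%N) (g 0 i + (s i)%:Z - i%:Z).
  by apply: sumr_ge0 => i _; apply: H.
have le1 : (\sum_(i < ell | z <= i) (s i - z) <= \sum_(i < ell | z <= i) (i - z))%N.
  have -> : (\sum_(i < ell | z <= i) (i - z) = \sum_(i < ell) (i - z))%N.
    rewrite [RHS](bigID (fun i : 'I_ell => z <= i)%N) /= [X in (_ + X)%N]big1 ?addn0 //.
    move=> i; lia.
  rewrite [X in (_ <= X)%N](reindex_inj (@perm_inj _ s)) /=.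
  by rewrite [X in (_ <= X)%N](bigID (fun i : 'I_ell => z <= i)%N) /= leq_addr.
have le2 : \sum_(i < ell | (z <= i)%N) (s i)%:Z <= \sum_(i < ell | (z <= i)%N) (i%:Z).
  have e1 : \sum_(i < ell | (z <= i)%N) ((s i)%:Z - z%:Z) <= (\sum_(i < ell | z <= i) (s i - z))%N%:Z.
    rewrite -[X in _ <= X]natz natr_sum; apply: ler_sum => i _; rewrite natz; lia.
  have e2 : \sum_(i < ell | (z <= i)%N) (i%:Z - z%:Z) = (\sum_(i < ell | z <= i) (i - z))%N%:Z.
    rewrite -[RHS]natz natr_sum; apply: eq_bigr => i zi; rewrite natz; lia.
  rewrite -(lerD2r (- \sum_(i < ell | (z <= i)%N) z%:Z)) -!sumrB e2.
  by apply: le_trans e1 _; rewrite lez_nat.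
rewrite sumrB big_split /= subr_ge0 => ge0.
have := le_trans ge0 (lerD (lexx _) le2).
by rewrite -[X in X <= _]add0r lerD2r leNgt neg.
Qed.

(** A positive root moves a unit to a smaller index, so it never increases the sum over the indices
    from z on; all Schur functions in the expansion vanish. *)
Lemma catalan_tail_neg ell (Psi : {set 'I_ell * 'I_ell}) (g : 'rV[int]_ell) d (z : nat) :
  Psi \subset posroots ell -> \sum_(i < ell | (z <= i)%N) g 0 i < 0 ->
  catalan Psi g d = 0.
Proof.
move: Psi g d; apply: catalan_ind => [g d _ neg|Psi g d [i j] aP IH1 IH2 sub neg].
  by rewrite catalan0 (schur_tail_neg neg) if_same.
rewrite (catalan_remove _ _ aP) IH1 ?(subset_trans (subsetDl _ _)) // add0r.
case: d IH1 IH2 => [|d] _ IH2; first by [].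
rewrite (IH2 _ erefl sub) //.
have ij : (i < j)%N by have := subsetP sub _ aP; rewrite inE.
have eps_sum (r : 'I_ell) : \sum_(i < ell | (z <= i)%N) (eps r : 'rV[int]_ell) 0 i = (z <= r)%N%:R.
  rewrite (bigID (pred1 r)) /= addrC big1 ?add0r => [|u /andP[_ /negPf ur]]; last by rewrite mxE ur.
  have [zr|zr] := boolP (z <= r)%N.
    rewrite (big_pred1 r) ?mxE ?eqxx // => u /=.
    by case: eqVneq => [->|]; rewrite ?zr ?andbF.
  by rewrite big1 // => u /andP[zu /eqP ur]; rewrite -ur zu in zr.
rewrite (eq_bigr (fun u => g 0 u + (eps i 0 u - eps j 0 u))) => [|u _]; last by rewrite !mxE.
rewrite big_split sumrB /= !eps_sum; apply: le_lt_trans neg.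
rewrite -[X in _ <= X]addr0 lerD2l subr_le0 ler_nat.
by case: (leqP z i) => // zi; rewrite (leq_trans zi (ltnW ij)).
Qed.

(** * Padding a weight by zeros *)

Definition restrict_roots ell (Psi : {set 'I_ell.+1 * 'I_ell.+1}) : {set 'I_ell * 'I_ell} :=
  [set a | (lift ord_max a.1, lift ord_max a.2) \in Psi].

Lemma schur_restrict ell (g : 'rV[int]_ell.+1) : g 0 ord_max = 0 ->
  schur g = schur (\row_(i < ell) g 0 (lift ord_max i)).
Proof.
move=> g0; rewrite /schur (expand_det_row _ ord_max) (bigD1 ord_max) //= mxE g0.
rewrite add0r subrr mul1r big1 ?addr0 => [|j jn]; last first.
  rewrite mxE g0 add0r; have : (j < ell)%N.
    by have := ltn_ord j; move: jn; rewrite -val_eqE /=; lia.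
  move=> lt; case E: (_ - _) => [m|m]; first by move: E => /=; lia.
  by rewrite mul0r.
rewrite /cofactor addnn -signr_odd odd_double mul1r; congr (\det _).
by apply/matrixP=> i j; rewrite !mxE !lift_max.
Qed.

(** A root ending at the last index makes the last entry negative and so contributes nothing; the
    remaining roots do not involve that index. *)
Lemma catalan_restrict ell (Psi : {set 'I_ell.+1 * 'I_ell.+1}) (g : 'rV[int]_ell.+1) d :
  Psi \subset posroots ell.+1 -> g 0 ord_max = 0 ->
  catalan Psi g d = catalan (restrict_roots Psi) (\row_(i < ell) g 0 (lift ord_max i)) d.
Proof.
move: Psi g d; apply: catalan_ind => [g d _ g0|Psi g d [i j] aP IH1 IH2 sub g0].
  have -> : restrict_roots set0 = set0 :> {set 'I_ell * 'I_ell} by apply/setP=> a; rewrite !inE.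
  by rewrite !catalan0 schur_restrict.
have ij : (i < j)%N by have := subsetP sub _ aP; rewrite inE.
rewrite (catalan_remove _ _ aP) IH1 ?(subset_trans (subsetDl _ _)) //=.
case: (unliftP ord_max i) => [i'|] iE; last first.
  by have := ltn_ord j; move: ij; rewrite iE /=; lia.
case: (unliftP ord_max j) => [j'|] jE; last first.
  have -> : (if d is d'.+1 then catalan Psi (g + (eps i - eps j)) d' else 0) = 0.
    case: d {IH1 IH2} => // d; apply: (@catalan_tail_neg _ _ _ _ ell) => //.
    rewrite (big_pred1 ord_max) => [|u /=]; last first.
      by rewrite -val_eqE /=; have := ltn_ord u; lia.
    by rewrite !mxE g0 jE iE !eqxx (negPf (neq_lift _ _)).
  rewrite addr0.
  congr catalan; apply/setP=> -[u v]; rewrite !inE /= xpair_eqE.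
  by rewrite [X in _ && (_ == X)]jE (eq_sym _ ord_max) (negPf (neq_lift _ _)) andbF.
have bP : (i', j') \in restrict_roots Psi by rewrite inE /= -iE -jE.
rewrite (catalan_remove _ _ bP); congr (_ + _).
  congr catalan; apply/setP=> -[u v]; rewrite !inE /= !xpair_eqE iE jE.
  by rewrite !(inj_eq lift_inj).
case: d IH1 IH2 => [|d] _ IH2; first by [].
rewrite (IH2 _ erefl sub); last first.
  by rewrite !mxE g0 iE jE !(negPf (neq_lift _ _)).
have -> // : \row_(u < ell) (g + (eps i - eps j)) 0 (lift ord_max u)
             = \row_(u < ell) g 0 (lift ord_max u) + (eps i' - eps j').
by apply/rowP=> u; rewrite !mxE iE jE !(inj_eq lift_inj).
Qed.

(* [kcat k ell g] is the series s^(k)_g, for an arbitrary integer weight g with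
   parts at most k; only the values of g below ell matter. *)
Definition kcat (k ell : nat) (g : nat -> int) : tseries :=
  catalan (Delta k (\row_(i < ell) g i)) (\row_(i < ell) g i).

Lemma eq_kcat k ell g g' : (forall r, (r < ell)%N -> g r = g' r) -> kcat k ell g = kcat k ell g'.
Proof.
move=> gg'; rewrite /kcat; have -> // : \row_(i < ell) g i = \row_(i < ell) g' i.
by apply/rowP=> i; rewrite !mxE gg'.
Qed.

Lemma Delta_sub k ell (g : 'rV[int]_ell) : Delta k g \subset posroots ell.
Proof. by apply/subsetP=> a; rewrite inE => /andP[]. Qed.

Lemma kcat_pad k ell (g : nat -> int) d : g ell = 0 -> kcat k ell.+1 g d = kcat k ell g d.
Proof.
move=> g0; rewrite /kcat (catalan_restrict _ (Delta_sub _ _)); last by rewrite mxE.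
have -> : \row_(i < ell) (\row_(i < ell.+1) g i) 0 (lift ord_max i) = \row_(i < ell) g i.
  by apply/rowP=> i; rewrite !mxE lift_max.
have -> // : restrict_roots (Delta k (\row_(i < ell.+1) g i)) = Delta k (\row_(i < ell) g i).
by apply/setP=> -[i j]; rewrite !inE !mxE !lift_max.
Qed.

Lemma kcat_pads k ell ell' (g : nat -> int) d : (ell <= ell')%N ->
  (forall r, (ell <= r)%N -> g r = 0) -> kcat k ell' g d = kcat k ell g d.
Proof.
move=> le g0; rewrite -(subnKC le); elim: (ell' - ell)%N => [|m IH]; first by rewrite addn0.
by rewrite addnS kcat_pad ?g0 // leq_addr.
Qed.

Definition root_start (k : nat) (g : nat -> int) (r : nat) : int := r%:Z + k.+1%:Z - g r.

Lemma roots_ext ell (A B : {set 'I_ell * 'I_ell}) :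
  (forall i j : 'I_ell, ((i, j) \in A) = ((i, j) \in B)) -> A = B.
Proof. by move=> AB; apply/setP=> -[i j]; apply: AB. Qed.

Lemma mem_Delta k ell (g : nat -> int) (i j : 'I_ell) :
  (forall r, (r < ell)%N -> g r <= k%:Z) ->
  ((i, j) \in Delta k (\row_(i < ell) g i)) = (root_start k g i <= j%:Z).
Proof.
move=> gk; have := gk _ (ltn_ord i); rewrite !inE mxE /root_start /=; lia.
Qed.

Lemma tperm_succ ell (x x' i : 'I_ell) : x' = x.+1 :> nat ->
  tperm x x' i = (if i == x :> nat then x.+1 else if i == x.+1 :> nat then x else i) :> nat.
Proof.
move=> e; case: tpermP => [->|->|/eqP ne1 /eqP ne2].
- by rewrite eqxx.
- by rewrite e eqxx; case: eqP => //; lia.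
by rewrite -e !val_eqE (negPf ne1) (negPf ne2).
Qed.

(** * Straightening at two adjacent rows *)

Section Mirror.

Variables (k ell : nat) (g : nat -> int) (x : nat).
Hypothesis gk : forall r, (r < ell)%N -> g r <= k%:Z.
Hypothesis xl : (x.+1 < ell)%N.
Hypothesis gx : g x.+1 = g x + 1.
Local Notation f := (root_start k g).

(** Rows x and x+1 start at the same column, since [root_start] agrees on them, and columns x and
    x+1 hold the same roots, since no row starts at x+1. Hence the root set is invariant under the
    swap. *)
Lemma kcat_mirror0 d : (forall w, (w < ell)%N -> f w <> x.+1%:Z) -> kcat k ell g d = 0.
Proof.
move=> nw; pose x0 := Ordinal (ltnW xl); pose x1 := Ordinal xl.
have x1E : x1 = x0.+1 :> nat by [].
apply: (catalan_dot_fixed x1E); last by rewrite !mxE.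
apply: roots_ext => i j; rewrite inE !mem_Delta //=.
rewrite /root_start !(tperm_succ _ x1E) /=.
have := nw i (ltn_ord i); have := nw _ xl; rewrite /root_start.
case: i j => [I Il] [J Jl] /=.
case: (eqVneq I x) => [->|?]; [|case: (eqVneq I x.+1) => [->|?]];
  (case: (eqVneq J x) => [->|?]; [|case: (eqVneq J x.+1) => [->|?]]);
  rewrite /= ?eqxx ?(gtn_eqF (ltnSn _)) ?(ltn_eqF (ltnSn _)) /=; lia.
Qed.

(** With Phi the roots of g and Psi = Phi + (w, x), 0 = H(Psi; g) = H(Phi; g) + t H(Psi; g + e_w -
    e_x), and the dot action turns the last weight into g + e_w - e_(x+1) with a change of sign. *)
Lemma kcat_mirror w d : (w < ell)%N -> f w = x.+1%:Z ->
  (forall r, (r < ell)%N -> f r = x.+1%:Z -> r = w) ->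
  kcat k ell g d =
  if d is d'.+1
  then kcat k ell (fun r => g r + (r == w)%:R - (r == x.+1)%:R) d' else 0.
Proof.
move=> wl fw uw; pose x0 := Ordinal (ltnW xl); pose x1 := Ordinal xl.
have x1E : x1 = x0.+1 :> nat by [].
(* The case w = x is excluded because f x = f (x+1), and the latter exceeds x+1. *)
have wx : (w < x)%N.
  have := gk wl; have := gk xl; move: fw gx; rewrite /root_start.
  case: (ltngtP w x) => // [|->]; lia.
pose w0 := Ordinal wl.
have [w01 w00] : w0 != x1 /\ w0 != x0 by rewrite -!val_eqE /=; lia.
set g' := (fun r => _).
have g'k r : (r < ell)%N -> g' r <= k%:Z.
  move=> rl; rewrite /g'; have := gk rl; case: (eqVneq r w) => [->|_] /=; last lia.
  move: fw; rewrite /root_start; lia.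
pose a : 'I_ell * 'I_ell := (w0, x0).
set Phi := Delta k (\row_(i < ell) g i).
pose Psi := a |: Phi.
have aP : a \in Psi by rewrite !inE eqxx.
have aPhi : a \notin Phi by rewrite /Phi mem_Delta //= fw; lia.
have PhiE : Psi :\ a = Phi by rewrite setU1K.
have memPsi i j : ((i, j) \in Psi) = (i == w :> nat) && (j == x :> nat) || (f i <= j%:Z).
  by rewrite inE /Phi mem_Delta // inE xpair_eqE.
(* Adding the root (w, x) makes the root set symmetric in x and x+1. *)
have swP : swap_roots x0 x1 Psi = Psi.
  apply: roots_ext => i j; rewrite inE !memPsi !(tperm_succ _ x1E) /=.
  have := uw i (ltn_ord i); have := uw _ xl; have := uw _ (ltnW xl); move: fw.
  rewrite /root_start.
  case: i j => [I Il] [J Jl] /=.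
  case: (eqVneq I x) => [->|?]; [|case: (eqVneq I x.+1) => [->|?]];
    (case: (eqVneq J x) => [->|?]; [|case: (eqVneq J x.+1) => [->|?]]);
    rewrite /= ?eqxx ?(gtn_eqF (ltnSn _)) ?(ltn_eqF (ltnSn _)) /=; try lia;
    case: (eqVneq I w) => [->|?];
  rewrite /= ?eqxx ?(gtn_eqF (ltnSn _)) ?(ltn_eqF (ltnSn _)) /=; lia.
have := catalan_remove (\row_(i < ell) g i) d aP.
rewrite (catalan_dot_fixed x1E d swP); last by rewrite !mxE.
rewrite PhiE => /esym/eqP; rewrite addrC addr_eq0 => /eqP.
rewrite /kcat -/Phi; case: d => [|d] E; first by rewrite -[LHS]opprK -E oppr0.
have := catalan_dot x1E Psi (\row_(i < ell) g i + (eps w0 - eps x0)) d.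
have -> : dot_swap x0 x1 (\row_(i < ell) g i + (eps w0 - eps x0)) = \row_(i < ell) g' i.
  apply/rowP=> i; rewrite !mxE -!val_eqE /= !(tperm_succ _ x1E) /= /g'.
  case: i => [I Il] /=.
  case: (eqVneq I x) => [->|?]; [|case: (eqVneq I x.+1) => [->|?]];
  rewrite /= ?eqxx ?(gtn_eqF (ltnSn _)) ?(ltn_eqF (ltnSn _)) /=; lia.
rewrite swP E opprK => <-.
have f'E (i : nat) : root_start k g' i = f i - (i == w)%:R + (i == x.+1)%:R.
  by rewrite /root_start /g'; ring.
(* Psi and the roots of g' differ at most by the first root of row x+1, which exists only if its
   column is below ell. *)
have [yl|yl] := ltP (f x.+1) ell%:Z; last first.
  have -> // : Psi = Delta k (\row_(i < ell) g' i).
  apply: roots_ext => i j; rewrite memPsi mem_Delta //= f'E.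
  have := ltn_ord j; move: fw.
  case: i j => [I Il] [J Jl] /=.
  by case: (eqVneq I x.+1) => [->|?]; [|case: (eqVneq I w) => [->|?]];
  rewrite /= ?eqxx ?(gtn_eqF (ltnSn _)) ?(ltn_eqF (ltnSn _)) /=; lia.
have y0 : (`|f x.+1| < ell)%N by have := gk xl; move: yl; rewrite /root_start; lia.
pose b : 'I_ell * 'I_ell := (x1, Ordinal y0).
have y0E : (`|f x.+1|%N%:Z = f x.+1) by have := gk xl; rewrite /root_start; lia.
have bP : b \in Psi by rewrite memPsi /= y0E lexx orbT.
rewrite (catalan_remove _ _ bP).
have -> : Psi :\ b = Delta k (\row_(i < ell) g' i).
  apply: roots_ext => i j; rewrite in_setD1 memPsi mem_Delta //= f'E xpair_eqE -!val_eqE /=.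
  have := ltn_ord j; move: fw y0E.
  case: i j => [I Il] [J Jl] /=.
  by case: (eqVneq I x.+1) => [->|?]; [|case: (eqVneq I w) => [->|?]];
  rewrite /= ?eqxx ?(gtn_eqF (ltnSn _)) ?(ltn_eqF (ltnSn _)) /=; lia.
(* Removing the first root of row x+1 costs a term that is symmetric again. *)
have -> : (if d is d'.+1 then catalan Psi (\row_(i < ell) g' i + (eps b.1 - eps b.2)) d' else 0) = 0.
  case: d {E} => // d; apply: (catalan_dot_fixed x1E) => //.
  have yx : (x.+1 < `|f x.+1|)%N by have := gk xl; move: y0E; rewrite /root_start; lia.
  rewrite !mxE -!val_eqE /= /g'; move: (`|f x.+1|)%N yx => y yx.
  rewrite ?eqxx ?(ltn_eqF (ltnSn x)) ?(gtn_eqF (ltnSn x)) ?(ltn_eqF yx) ?(ltn_eqF (ltnW yx)).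
  by rewrite ?(gtn_eqF wx) ?(gtn_eqF (ltnW wx)) /=; lia.
by rewrite addr0.
Qed.

End Mirror.

Local Open Scope nat_scope.

(** * Cores and bounded partitions *)

(* T is the top row of a runner, with rows z_i = iter i d T. The beads of rows
   z_0, ..., z_a slide down, each past the beads of rows z_i+1, ..., z_i+h-1. In
   [cover_data] the slid beads land on a runner whose top row is z_(a+1)+h. *)
Definition ladder (d : nat -> nat) (T a h : nat) : Prop :=
  [/\ 0 < h, forall y, d y <> T,
      forall s i, s <= a -> i < h -> d (iter s d T + i) = iter s.+1 d T + i,
      forall i, 0 < i < h -> exists y, d y = T + i
    & iter a d T + h <= iter a.+1 d T].

Definition cover_data (d : nat -> nat) (T a h : nat) : Prop :=
  ladder d T a h /\ forall y, d y <> iter a.+1 d T + h.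

Section Ladder.

Variable d : nat -> nat.
Hypothesis dmono : {mono d : r s / r < s}.
Hypothesis dgt : forall r, r < d r.

Lemma lt_mono_leq r s : (d r <= d s) = (r <= s).
Proof. by rewrite leqNgt dmono -leqNgt. Qed.

Lemma lt_mono_inj r s : d r = d s -> r = s.
Proof. by move=> e; apply/eqP; rewrite eqn_leq -(lt_mono_leq r) -(lt_mono_leq s) e leqnn. Qed.

Lemma leq_iter s T : T + s <= iter s d T.
Proof. by elim: s => [|s IH]; rewrite ?addn0 // addnS; apply: leq_ltn_trans IH (dgt _). Qed.

(** Descending induction on s: if z_(s+1) = z_s + i with i < h, the ladder relation gives z_(s+2) =
    z_(s+1) + i, against the room at s+1. *)
Lemma ladder_room T a h s : ladder d T a h -> s <= a -> iter s d T + h <= iter s.+1 d T.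
Proof.
case=> h0 _ dz _ room; move: s; suff H t : t <= a -> iter (a - t) d T + h <= iter (a - t).+1 d T.
  by move=> s sa; rewrite -(subKn sa); apply: H; apply: leq_subr.
elim: t => [|t IH] ta; first by rewrite subn0.
have IH' := IH (ltnW ta).
rewrite leqNgt; apply/negP => lt.
have := dz (a - t.+1) (iter (a - t.+1).+1 d T - iter (a - t.+1) d T) (leq_subr _ _).
have := dgt (iter (a - t.+1) d T); move: IH' lt.
rewrite (_ : a - t = (a - t.+1).+1) ; last lia.
rewrite !iterS; move: (iter (a - t.+1) d T) => z IH' lt zd.
rewrite subnKC ?(ltnW zd) // => /(_ _); lia.
Qed.

Lemma ladder_le T a h h' : ladder d T a h -> 0 < h' <= h -> ladder d T a h'.
Proof.
case=> h0 nT dz up room /andP[h'0 h'h]; split=> //.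
- by move=> s i sa ih; apply: dz => //; apply: leq_trans h'h.
- by move=> i /andP[i0 ih]; apply: up; rewrite i0 (leq_trans ih).
by apply: leq_trans room; rewrite leq_add2l.
Qed.

End Ladder.

(* In a core with parts l the bead of row [bounce k l r] lies k+1 positions
   below the bead of row r, so that iterating [bounce k l] follows a runner. *)
Definition bounce (k : nat) (l : nat -> nat) (r : nat) : nat := r + k.+1 - l r.

Section Bounce.

Variables (k : nat) (l : nat -> nat).
Hypothesis lk : forall r, l r <= k.

Lemma bounce_gt r : r < bounce k l r.
Proof. by have := lk r; rewrite /bounce; lia. Qed.

Hypothesis l_noninc : forall r s, r <= s -> l s <= l r.

Lemma bounce_mono : {mono bounce k l : r s / r < s}.
Proof.
move=> r s; rewrite /bounce; have := lk r; have := lk s.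
by case: (leqP s r) => rs; [have := l_noninc rs|have := l_noninc (ltnW rs)]; lia.
Qed.

End Bounce.

(** * Partitions, hooks and beads *)

Lemma partition_nth_le s r r' : is_partition s -> r <= r' -> nth 0 s r' <= nth 0 s r.
Proof.
case/andP=> srt _ rr'; case: (ltnP r' (size s)) => r's; last by rewrite nth_default.
by have := sorted_leq_nth (rev_trans leq_trans) leqnn 0 srt r r'; rewrite !inE (leq_ltn_trans rr') // r's => /(_ isT isT rr').
Qed.

Lemma partition_nth_gt0 s r : is_partition s -> (0 < nth 0 s r) = (r < size s).
Proof.
case/andP=> _ s0; case: (ltnP r (size s)) => rs; last by rewrite nth_default.
by rewrite lt0n; apply: contra s0 => /eqP<-; apply: mem_nth.
Qed.

Lemma partition_ext s t : is_partition s -> is_partition t ->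
  (forall r, nth 0 s r = nth 0 t r) -> s = t.
Proof.
move=> ps pt st; apply: (@eq_from_nth _ 0) => [|r _]; last exact: st.
apply/eqP; rewrite eqn_leq; apply/andP; split; rewrite leqNgt.
  by rewrite -(partition_nth_gt0 _ ps) st (partition_nth_gt0 _ pt) ltnn.
by rewrite -(partition_nth_gt0 _ pt) -st (partition_nth_gt0 _ ps) ltnn.
Qed.

Lemma partition_of_fun (S : nat -> nat) L :
  (forall r r', r <= r' -> S r' <= S r) -> (forall r, L <= r -> S r = 0) ->
  exists2 s, is_partition s & forall r, nth 0 s r = S r.
Proof.
elim: L S => [|L IH] S mono supp.
  by exists [::] => // r; rewrite nth_nil supp.
have [||s /andP[srt s0] sE] := IH (fun r => S r.+1).
- by move=> r r' rr'; apply: mono.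
- by move=> r Lr; apply: supp.
have [S0|S0] := posnP (S 0).
  by exists [::] => // r; rewrite nth_nil; apply/esym/eqP; rewrite -leqn0 -S0 mono.
exists (S 0 :: s); last by case.
rewrite /is_partition inE negb_or eq_sym -lt0n S0 s0 /= !andbT.
case: s srt {s0} sE => //= x s -> sE; rewrite andbT.
by have := sE 0; rewrite /= => ->; apply: mono.
Qed.

Lemma sorted_count_gt (t : seq nat) c i : sorted geq t ->
  (i < count (fun p => c < p) t) = (c < nth 0 t i).
Proof.
elim: t i => [|x t IH] i; first by rewrite nth_nil !ltn0.
move=> srt; have srt' : sorted geq t by apply: path_sorted srt.
rewrite /=; case: (ltnP c x) => cx; first by case: i => [|i]; rewrite //= add1n ltnS IH.
have le : all (fun p => p <= c) t.
  move: srt => /= /(order_path_min (rev_trans leq_trans)) /allP H; apply/allP=> y /H /= yx.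
  exact: leq_trans yx cx.
have -> : count (fun p => c < p) t = 0.
  by apply/eqP; rewrite -leqn0 leqNgt -has_count -all_predC; apply: sub_all le => y /=; rewrite -leqNgt.
rewrite add0n ltn0; apply/esym/negbTE; rewrite -leqNgt.
case: i => [|i] //=; case: (ltnP i (size t)) => it; last by rewrite nth_default.
exact: (allP le) (mem_nth 0 it).
Qed.

(** Here m is the leg length; described by comparisons of row lengths, it turns hook conditions into
    linear arithmetic. *)
Lemma hookP s r c : is_partition s ->
  exists2 m, hook s r c = nth 0 s r - c + m & forall i, (i < m) = (c < nth 0 s (r.+1 + i)).
Proof.
move=> /andP[srt _]; exists (count (fun p => c < p) (drop r.+1 s)) => // i.
by rewrite sorted_count_gt ?nth_drop // drop_sorted.
Qed.

Definition bead (s : seq nat) (r : nat) : int := ((nth 0%N s r)%:Z - r%:Z)%R.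

Definition bead_closed (k : nat) (s : seq nat) : Prop :=
  forall r, exists j, (bead s j = bead s r - k.+1%:Z)%R.

Lemma bead_lt s r r' : is_partition s -> (bead s r' < bead s r)%R = (r < r').
Proof.
move=> ps; rewrite /bead; case: (leqP r' r) => rr'.
  by have := partition_nth_le ps rr'; lia.
by have := partition_nth_le ps (ltnW rr'); lia.
Qed.

Lemma bead_inj s r r' : is_partition s -> bead s r = bead s r' -> r = r'.
Proof.
move=> ps e; have := bead_lt r r' ps; have := bead_lt r' r ps; rewrite e ltxx.
by case: ltngtP.
Qed.

Lemma core_bead_closed k s : is_core k s -> bead_closed k s.
Proof.
move=> [ps hk] r.
have ex : exists j, (bead s j <= bead s r - k.+1%:Z)%R.
  exists (r + k.+1 + nth 0 s r); rewrite /bead.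
  by have := partition_nth_le ps (leq_trans (leq_addr k.+1 r) (leq_addr (nth 0 s r) _)); lia.
case: (ex_minnP ex) => j jle jmin; exists j; apply/eqP; rewrite eq_le jle /= leNgt.
apply/negP => jlt.
have rj : r < j.
  by rewrite -(bead_lt _ _ ps); lia.
have j1 : (bead s r - k.+1%:Z < bead s j.-1)%R.
  by rewrite ltNge; apply/negP => /jmin; lia.
have s1 := partition_nth_le ps (r := r) (r' := j.-1).
rewrite /bead in jlt j1.
(* The column of the gap at position b_r - (k+1), between the beads of rows j-1 and j. The box (r,
   c) has leg j-1-r, hence hook length k+1. *)
pose c := nth 0 s r + j.-1 - r - k.+1.
have cE : (c%:Z = (nth 0%N s r)%:Z + j.-1%:Z - r%:Z - k.+1%:Z)%R by rewrite /c; lia.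
have {}s1 : nth 0 s j.-1 <= nth 0 s r by apply: s1; lia.
have cr : c < nth 0 s r by lia.
apply: (hk r c cr); have [m -> mP] := hookP r c ps.
suff : m = j.-1 - r by lia.
have h1 := mP (j.-1 - r); rewrite (_ : r.+1 + (j.-1 - r) = j) in h1; last lia.
have h2 := mP m; rewrite ltnn in h2.
have h3 : r.+1 + m <= j.-1 -> nth 0 s j.-1 <= nth 0 s (r.+1 + m) by apply: partition_nth_le.
lia.
Qed.

Section Core.

Variables (k : nat) (s : seq nat).
Hypothesis ps : is_partition s.

Lemma bead_closed_core : bead_closed k s -> is_core k s.
Proof.
move=> cl; split=> // r c cr; have [m -> mP] := hookP r c ps; have [j jE] := cl r => mE.
have rj : r < j by rewrite -(bead_lt _ _ ps) jE; lia.
have := mP (j - r.+1); rewrite subnKC // /bead in jE *; lia.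
Qed.

(** The leg of (r, c) drops below j - r exactly when column c does not reach row j, and this is
    where the hook length becomes at most k. *)
Lemma nth_core_part r j : bead s j = (bead s r - k.+1%:Z)%R ->
  nth 0 (core_part k s) r = nth 0 s r - nth 0 s j.
Proof.
move=> jE; have rj : r < j by rewrite -(bead_lt _ _ ps) jE; lia.
have [rs|rs] := ltnP r (size s); last first.
  by rewrite nth_default ?size_map ?size_iota // (nth_default 0 rs).
rewrite (nth_map 0) ?size_iota // nth_iota // add0n.
have -> : nth 0 s r - nth 0 s j = count (fun c => nth 0 s j <= c) (iota 0 (nth 0 s r)).
  elim: (nth 0 s r) => // x IH; rewrite -addn1 iotaD count_cat -IH /= addn0 add0n; lia.
apply: eq_in_count => c; rewrite mem_iota add0n /= => cr.
have [m -> mP] := hookP r c ps.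
have := mP (j - r.+1); rewrite subnKC // /bead in jE *; lia.
Qed.

End Core.

Notation part_of k s := (nth 0 (core_part k s)).

Section CoreParts.

Variables (k : nat) (s : seq nat).
Hypothesis cs : is_core k s.
Let ps : is_partition s. Proof. by case: cs. Qed.

Lemma core_next r : exists2 j, bead s j = (bead s r - k.+1%:Z)%R &
  [/\ r < j, j <= r + k.+1 & part_of k s r + j = r + k.+1].
Proof.
have [j jE] := core_bead_closed cs r; exists j => //.
have rj : r < j by rewrite -(bead_lt _ _ ps) jE; lia.
have le := partition_nth_le ps (ltnW rj).
by rewrite (nth_core_part ps jE); rewrite /bead in jE; split=> //; lia.
Qed.

Lemma core_part_le r : part_of k s r <= k.
Proof. by have [j _ [h1 h2 h3]] := core_next r; lia. Qed.

Lemma bead_bounce r : bead s (bounce k (part_of k s) r) = (bead s r - k.+1%:Z)%R.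
Proof.
have [j jE [h1 h2 h3]] := core_next r.
by have -> : bounce k (part_of k s) r = j by rewrite /bounce; lia.
Qed.

Lemma nth_core_rec r :
  nth 0 s r = part_of k s r + nth 0 s (bounce k (part_of k s) r).
Proof.
have e : bounce k (part_of k s) r = r + k.+1 - part_of k s r by [].
by have := bead_bounce r; have := core_part_le r; rewrite /bead; lia.
Qed.

Lemma core_part_supp r : size s <= r -> part_of k s r = 0.
Proof. by move=> sr; rewrite nth_default // size_map size_iota. Qed.

(** The beads of rows r+1, ..., r' have distinct beads k+1 positions below them, all after row j and
    none after row j'; so j' - j >= r' - r. *)
Lemma core_part_noninc r r' : r <= r' -> part_of k s r' <= part_of k s r.
Proof.
rewrite leq_eqVlt => /orP[/eqP-> //|rr'].
have [j jE [h1 h2 h3]] := core_next r; have [j' jE' [h1' h2' h3']] := core_next r'.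
have : (bead s j' < bead s j)%R by rewrite jE jE' ltrD2r bead_lt.
rewrite bead_lt // => jj'.
suff H : r' - r <= j' - j by lia.
have step n : r + n <= r' -> exists2 i, j + n <= i & bead s i = (bead s (r + n) - k.+1%:Z)%R.
  elim: n => [|n IH] rn; first by exists j; rewrite ?addn0.
  have [|i ji iE] := IH; first lia.
  have [i' iE' _] := core_next (r + n.+1); exists i' => //.
  have : (bead s i' < bead s i)%R by rewrite iE iE' ltrD2r bead_lt // addnS.
  by rewrite bead_lt //; lia.
have [|i ji iE] := step (r' - r); first by lia.
rewrite subnKC ?(ltnW rr') // -jE' in iE.
have ij' := bead_inj ps iE; lia.
Qed.

Lemma sumn_core_part L : size s <= L -> sumn (core_part k s) = \sum_(r < L) part_of k s r.
Proof.
move=> sL; rewrite sumnE (big_nth 0) size_map size_iota -(subnKC sL).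
rewrite -(big_mkord xpredT (fun r => part_of k s r)) /index_iota !subn0.
rewrite [in RHS]iotaD big_cat /= [X in _ + X]big1_seq ?addn0 // => i /andP[_].
by rewrite mem_iota add0n => /andP[si _]; apply: core_part_supp.
Qed.

End CoreParts.

Lemma core_part_inj k s t : is_core k s -> is_core k t ->
  (forall r, part_of k s r = part_of k t r) -> s = t.
Proof.
move=> cs ct st; apply: partition_ext; [by case: cs|by case: ct|move=> r].
have [n] := ubnP (size s + size t - r); elim: n r => // n IH r; rewrite ltnS => rn.
have [sr|rs] := leqP (size s + size t) r.
  by rewrite !nth_default //; lia.
rewrite (nth_core_rec cs) (nth_core_rec ct) st.
have bE : bounce k (part_of k s) r = bounce k (part_of k t) r by rewrite /bounce st.
rewrite bE IH //.
by have := bounce_gt (core_part_le ct) r; lia.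
Qed.

(** The rows are forced by s_r = l_r + s_(d(r)). In [rows] the argument f is fuel, and L - r is
    enough because d(r) > r and l vanishes from L on. *)
Lemma core_of_part k (l : nat -> nat) L : (forall r, l r <= k) ->
  (forall r r', r <= r' -> l r' <= l r) -> (forall r, L <= r -> l r = 0) ->
  exists2 s, is_core k s & forall r, part_of k s r = l r.
Proof.
move=> lk mono supp.
pose rows := fix rows f r {struct f} :=
  if f is f'.+1 then l r + rows f' (bounce k l r) else 0.
have dgt := bounce_gt lk.
have lt_mono_leq := lt_mono_leq (bounce_mono lk mono).
have rows0 f r : L <= r -> rows f r = 0.
  elim: f r => //= f IH r Lr; rewrite supp // IH //.
  by apply: leq_trans Lr (ltnW (dgt _)).
have stable f f' r : L - r <= f -> L - r <= f' -> rows f r = rows f' r.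
  elim: f f' r => [|f IH] f' r h1 h2; first by rewrite !rows0 //; lia.
  case: f' h2 => [|f'] h2; first by rewrite !rows0 //; lia.
  by rewrite /=; congr (_ + _); apply: IH; have := dgt r; lia.
pose S := rows L.
have SE r : S r = l r + S (bounce k l r).
  rewrite /S (stable L L.+1 r) //=; try lia.
have Smono r r' : r <= r' -> S r' <= S r.
  have [n] := ubnP (L - r); elim: n r r' => // n IH r r'; rewrite ltnS => rn rr'.
  have [Lr|rL] := leqP L r; first by rewrite /S !rows0 // (leq_trans Lr).
  rewrite (SE r) (SE r') leq_add ?mono // IH ?lt_mono_leq //.
  by have := dgt r; lia.
have [s ps sE] := partition_of_fun Smono (rows0 L).
have bE r : (bead s (bounce k l r) = bead s r - k.+1%:Z)%R.
  have e : bounce k l r = r + k.+1 - l r by [].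
  by rewrite /bead !sE (SE r); have := lk r; lia.
exists s; first by apply: bead_closed_core => // r; exists (bounce k l r).
by move=> r; rewrite (nth_core_part ps (bE r)) !sE (SE r) addnK.
Qed.

(** * Components of a skew shape *)

Section Components.

Variables (tau kappa : seq nat) (z : nat -> nat) (a h : nat).
Local Notation lo r := (nth 0 tau r).
Local Notation hi r := (nth 0 kappa r).
Local Notation box := ('I_(size kappa) * 'I_(head 0 kappa))%type.
Hypothesis h0 : 0 < h.
Hypothesis lo_anti : forall r r', r <= r' -> lo r' <= lo r.
Hypothesis hi_anti : forall r r', r <= r' -> hi r' <= hi r.
Hypothesis rowP : forall r, lo r < hi r <-> exists i j, [/\ i <= a, j < h & r = z i + j].
Hypothesis linkP : forall r, lo r < hi r.+1 <-> exists i j, [/\ i <= a, j.+1 < h & r = z i + j].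
Hypothesis zgap : forall i i', i < i' -> i' <= a -> z i + h <= z i'.

Local Notation D := (skew_boxes tau kappa).
Local Notation e := (fun x y : box => [&& x \in D, y \in D & edge_adjacent x y]).

Lemma skew_edge_sym : symmetric e.
Proof.
move=> x y; rewrite andbCA; congr [&& _, _ & _]; rewrite /edge_adjacent.
by rewrite (eq_sym y.1) (eq_sym y.2) [X in _ && X]orbC [X in _ || _ && X]orbC.
Qed.

Lemma skew_connected_sym (x y : box) : skew_connected tau x y = skew_connected tau y x.
Proof. exact: (sym_connect_sym skew_edge_sym). Qed.

Lemma mk_box r c : lo r <= c < hi r ->
  exists x : box, [/\ x \in D, x.1 = r :> nat & x.2 = c :> nat].
Proof.
move=> /andP[lc ch]; have rs : r < size kappa.
  by rewrite ltnNge; apply/negP => sr; move: ch; rewrite nth_default.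
have ch0 : c < head 0 kappa by rewrite -nth0; apply: leq_trans ch (hi_anti (leq0n r)).
by exists (Ordinal rs, Ordinal ch0); rewrite inE /= lc ch.
Qed.

Lemma connect_row (x y : box) : x \in D -> y \in D -> x.1 = y.1 -> x.2 <= y.2 ->
  skew_connected tau x y.
Proof.
have [m] := ubnP (y.2 - x.2); elim: m x => // m IH x; rewrite ltnS => le xD yD r12 c12.
have [e2|ne] := eqVneq x.2 y.2.
  have -> : x = y by case: x y r12 e2 {IH le xD yD c12} => [u v] [u' v'] /= -> ->.
  exact: connect0.
have lt : x.2 < y.2 by rewrite ltn_neqAle c12 andbT.
have [w [wD w1 w2]] : exists w : box, [/\ w \in D, w.1 = x.1 :> nat & w.2 = x.2.+1 :> nat].
  apply: mk_box; move: xD yD; rewrite !inE -r12 => /andP[l1 _] /andP[_ h2].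
  by rewrite (leq_trans l1) //=; apply: leq_ltn_trans lt h2.
have xw : connect e x w.
  apply: connect1; rewrite xD wD /edge_adjacent; apply/orP; left.
  by rewrite w2 eqxx andbT; apply/eqP/val_inj.
apply: connect_trans xw _; apply: IH => //; last by rewrite w2.
  by rewrite w2; move: le lt; lia.
by rewrite -r12; apply: val_inj.
Qed.

Lemma connect_row_sym (x y : box) : x \in D -> y \in D -> x.1 = y.1 :> nat ->
  skew_connected tau x y.
Proof.
move=> xD yD /val_inj xy; case: (leqP x.2 y.2) => c; first exact: connect_row.
by rewrite skew_connected_sym; apply: connect_row => //; apply: ltnW.
Qed.

(** Two consecutive rows of a block are joined in the first skew column of the upper one, which
    [linkP] places in both rows. *)
Lemma connect_block i j (x y : box) : i <= a -> j < h -> x \in D -> y \in D ->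
  x.1 = z i + j :> nat -> y.1 = z i :> nat -> skew_connected tau x y.
Proof.
move=> ia; elim: j x => [|j IH] x jh xD yD xE yE.
  by apply: connect_row_sym => //; rewrite xE yE addn0.
have lk : lo (z i + j) < hi (z i + j).+1 by apply/linkP; exists i, j.
have [u [uD u1 u2]] : exists u : box, [/\ u \in D, u.1 = (z i + j).+1 :> nat & u.2 = lo (z i + j) :> nat].
  by apply: mk_box; rewrite lk andbT; apply: lo_anti.
have [v [vD v1 v2]] : exists v : box, [/\ v \in D, v.1 = z i + j :> nat & v.2 = lo (z i + j) :> nat].
  by apply: mk_box; rewrite leqnn; apply: leq_trans lk (hi_anti (leqnSn _)).
apply: (connect_trans (y := u)); first by apply: connect_row_sym; rewrite ?xE ?u1 ?addnS.
apply: (connect_trans (y := v)); last by apply: IH => //; apply: ltnW.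
apply: connect1; rewrite uD vD /edge_adjacent; apply/orP; right.
by rewrite u1 v1 eqxx orbT andbT -val_eqE /= u2 v2.
Qed.

Definition block_boxes (i : nat) : {set box} := [set x in D | z i <= x.1 < z i + h].

(** A vertical edge between rows r and r+1 forces lo r < hi (r+1), and then [linkP] puts both rows
    in the same block. *)
Lemma block_closed i : i <= a -> closed e [pred x : box | z i <= x.1 < z i + h].
Proof.
have half (x y : box) i' : i' <= a -> x \in D -> y \in D -> x.1.+1 == y.1 :> nat -> x.2 == y.2 ->
    (z i' <= x.1 < z i' + h) = (z i' <= y.1 < z i' + h).
  move=> ia; rewrite !inE => /andP[xl xh] /andP[yl yh] /eqP y1 /eqP xy.
  have lk : lo x.1 < hi x.1.+1 by rewrite y1; apply: leq_ltn_trans xl _; rewrite xy.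
  move/linkP: lk => [i1 [j [i1a jh xE]]].
  have : i1 = i' \/ i1 < i' \/ i' < i1 by case: (ltngtP i1 i'); auto.
  rewrite -y1 xE; case=> [->|[lt|lt]]; first by lia.
    by have := zgap lt ia; lia.
  by have := zgap lt i1a; lia.
move=> ia x y /and3P[xD yD]; rewrite /edge_adjacent !inE /=.
case/orP => [/andP[/eqP-> _] //|/andP[e2 /orP[e1|e1]]].
  exact: half.
by apply/esym; apply: half => //; rewrite eq_sym.
Qed.

Lemma component_of i (x : box) : i <= a -> x \in D -> z i <= x.1 < z i + h ->
  [set y in D | skew_connected tau x y] = block_boxes i.
Proof.
move=> ia xD xi.
have H (y : box) : y \in D -> skew_connected tau x y = (z i <= y.1 < z i + h).
  move=> yD; apply/idP/idP => [xy|yi].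
    by have := closed_connect (block_closed ia) xy; rewrite !inE xi => <-.
  have [w [wD w1 _]] : exists w : box, [/\ w \in D, w.1 = z i :> nat & w.2 = lo (z i) :> nat].
    by apply: mk_box; rewrite leqnn; apply/rowP; exists i, 0; rewrite addn0.
  apply: (connect_trans (y := w)); last rewrite -/(skew_connected _ _ _) skew_connected_sym.
    by apply: (@connect_block i (x.1 - z i)) => //; lia.
  by apply: (@connect_block i (y.1 - z i)) => //; lia.
apply/setP=> y; rewrite [LHS]in_set [RHS]in_set.
by case: (boolP (y \in D)) => //= yD; apply: H.
Qed.

Lemma componentsE : components tau kappa = [set block_boxes i | i : 'I_a.+1].
Proof.
apply/setP=> C; apply/imsetP/imsetP => [[x xD ->]|[i _ ->]].
  have /rowP[i [j [ia jh xE]]] : lo x.1 < hi x.1.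
    by move: xD; rewrite inE => /andP[]; apply: leq_ltn_trans.
  exists (Ordinal (ia : i < a.+1)) => //; apply: component_of => //=.
  by rewrite xE; lia.
have ia : i <= a by rewrite -ltnS.
have [w [wD w1 _]] : exists w : box, [/\ w \in D, w.1 = z i :> nat & w.2 = lo (z i) :> nat].
  by apply: mk_box; rewrite leqnn; apply/rowP; exists i, 0; rewrite addn0.
by exists w => //; apply/esym; apply: component_of => //; rewrite w1; lia.
Qed.

Lemma rows_of_block i (r : 'I_(size kappa)) : i <= a ->
  (r \in rows_of (block_boxes i)) = (z i <= r < z i + h).
Proof.
move=> ia; apply/imsetP/idP => [[x]|ri]; first by rewrite inE => /andP[_ xi] ->.
have lohi : lo r < hi r by apply/rowP; exists i, (r - z i); split; lia.
have [w [wD w1 _]] : exists w : box, [/\ w \in D, w.1 = r :> nat & w.2 = lo r :> nat].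
  by apply: mk_box; rewrite leqnn.
by exists w; [rewrite inE wD w1|apply/esym/val_inj].
Qed.

Lemma block_row_size i j : i <= a -> j < h -> z i + j < size kappa.
Proof.
move=> ia jh; have : lo (z i + j) < hi (z i + j) by apply/rowP; exists i, j.
by rewrite ltnNge => lt; rewrite ltnNge; apply: contra lt => sz; rewrite nth_default.
Qed.

Lemma height_block i : i <= a -> height (block_boxes i) = h.
Proof.
move=> ia; rewrite /height.
pose f (j : 'I_h) : 'I_(size kappa) := Ordinal (block_row_size ia (ltn_ord j)).
have f_inj : injective f by move=> j j' /(congr1 val) /= /addnI /val_inj.
have -> : rows_of (block_boxes i) = [set f j | j : 'I_h].
  apply/setP=> r; rewrite rows_of_block //; apply/idP/imsetP => [ri|[j _ ->]].
    have jh : r - z i < h by lia.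
    by exists (Ordinal jh) => //; apply: val_inj => /=; lia.
  by rewrite /=; have := ltn_ord j; lia.
by rewrite card_imset // card_ord.
Qed.

Lemma block_boxes_inj : injective (fun i : 'I_a.+1 => block_boxes i).
Proof.
move=> i i' e12; have ia : i <= a by rewrite -ltnS.
have i'a : i' <= a by rewrite -ltnS.
pose r := Ordinal (block_row_size ia h0).
have : r \in rows_of (block_boxes i) by rewrite rows_of_block //=; lia.
rewrite e12 rows_of_block //= => ri'; apply: val_inj; case: (ltngtP i i') => // lt.
  by have := zgap lt i'a; lia.
by have := zgap lt ia; lia.
Qed.

Lemma top_rowP m : (exists2 C, C \in components tau kappa & is_top_row m C) <->
  exists2 i, i <= a & m = z i.
Proof.
split=> [[C]|[i ia ->]].
  rewrite componentsE => /imsetP[i _ ->]; have ia : i <= a by rewrite -ltnS.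
  case/andP => /existsP[r /andP[ri /eqP rm]] /forallP all; exists i => //.
  pose r0 := Ordinal (block_row_size ia h0).
  have := all r0; rewrite rows_of_block // in ri *.
  by rewrite rows_of_block //= => /implyP; lia.
have ia' : i < a.+1 by [].
exists (block_boxes i); first by rewrite componentsE; apply/imsetP; exists (Ordinal ia').
have lt := block_row_size ia h0; rewrite addn0 in lt.
apply/andP; split.
  by apply/existsP; exists (Ordinal lt); rewrite rows_of_block //= eqxx andbT; lia.
by apply/forallP=> r; rewrite rows_of_block //; apply/implyP; case/andP.
Qed.

(** The a+1 components have height h, and those entirely below row z q are the blocks with index
    greater than q. *)
Lemma cover_spinE q : q <= a -> cover_spin tau kappa (z q) = a - q + a.+1 * h.-1.
Proof.
move=> qa; rewrite /cover_spin.
have -> : #|components tau kappa| = a.+1.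
  by rewrite componentsE card_imset ?card_ord //; apply: block_boxes_inj.
have -> : common_height tau kappa = h.
  apply/eqP; rewrite eqn_leq; apply/andP; split.
    apply/bigmax_leqP => C; rewrite componentsE => /imsetP[i _ ->].
    by rewrite height_block // -ltnS.
  rewrite -{1}(height_block (leq0n a)); apply: leq_bigmax_cond.
  by rewrite componentsE; apply/imsetP; exists ord0.
rewrite subn1 addnC; congr (_ + _).
have -> : [set C in components tau kappa | [forall i in rows_of C, z q < i]]
        = [set block_boxes i | i : 'I_a.+1 & q < i].
  apply/setP=> C; rewrite inE componentsE; apply/andP/imsetP => [[/imsetP[i _ ->]]|[i qi ->]].
    have ia : i <= a by rewrite -ltnS.
    move/forallP => /(_ (Ordinal (block_row_size ia h0))); rewrite rows_of_block //= => all.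
    exists i => //; rewrite inE ltnNge; apply/negP; rewrite leq_eqVlt => /orP[/eqP iq|iq].
      by move: all; rewrite iq; lia.
    by have := zgap iq qa; lia.
  have ia : i <= a by rewrite -ltnS.
  split; first by apply: imset_f.
  apply/forallP=> r; rewrite rows_of_block //; apply/implyP => ri.
  by rewrite inE in qi; have := zgap qi ia; lia.
rewrite card_in_imset => [|i i' _ _]; last exact: block_boxes_inj.
have lt (j : 'I_(a - q)) : q.+1 + j < a.+1 by have := ltn_ord j; lia.
have f_inj : injective (fun j => Ordinal (lt j)).
  by move=> j j' /(congr1 val) /= /addnI /val_inj.
rewrite -[RHS]card_ord -(card_imset predT f_inj); apply: eq_card => i.
rewrite inE; apply/idP/imsetP => [qi|[j _ ->]]; last by rewrite /=; lia.
have ji : i - q.+1 < a - q by have := ltn_ord i; lia.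
by exists (Ordinal ji) => //; apply: val_inj => /=; lia.
Qed.

End Components.

Local Open Scope ring_scope.

(** * Straightening *)

Lemma tpow_mul0 (f : tseries) D : tpow_mul 0 f D = f D.
Proof. by rewrite /tpow_mul subn0. Qed.

Lemma tpow_mulS s (f : tseries) D : tpow_mul s.+1 f D.+1 = tpow_mul s f D.
Proof. by rewrite /tpow_mul ltnS subSS. Qed.

Lemma tpow_mulS0 s (f : tseries) : tpow_mul s.+1 f 0 = 0.
Proof. by rewrite /tpow_mul. Qed.

Lemma tpow_mulD s t (f g : tseries) D : (forall D, f D = tpow_mul t g D) ->
  tpow_mul s f D = tpow_mul (s + t) g D.
Proof.
move=> fg; rewrite /tpow_mul; case: (leqP s D) => sD.
  by rewrite fg /tpow_mul leq_subRL // subnDA.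
by have -> : (s + t <= D)%N = false by lia.
Qed.

Section Straighten.

Variables (k ell : nat) (l : nat -> nat).
Hypothesis lk : forall r, (l r <= k)%N.
Hypothesis l_noninc : forall r s, (r <= s)%N -> (l s <= l r)%N.
Hypothesis l_supp : forall r, (ell <= r)%N -> l r = 0%N.
Local Notation d := (bounce k l).

Local Notation bounce_gt := (bounce_gt lk).
Local Notation bounce_mono := (bounce_mono lk l_noninc).
Local Notation lt_mono_leq := (lt_mono_leq bounce_mono).
Local Notation lt_mono_inj := (lt_mono_inj bounce_mono).

(* The bounded partition of the core obtained by the slide (T, a, h). *)
Definition cover_weight (T a h r : nat) : int :=
  (l r)%:Z - (iter a d T <= r < iter a d T + h)%N%:R + (T < d r < T + h)%N%:R.

Section Step.

Variables (T a i : nat).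
Local Notation z s := (iter s d T).
Hypothesis lad : ladder d T a i.
Hypothesis dzi : d (z a + i) = (z a.+1 + i)%N.
Hypothesis zi_lt : (z a + i < ell)%N.

Let i0 : (0 < i)%N. Proof. by case: lad. Qed.
Let zroom s : (s <= a)%N -> (z s + i <= z s.+1)%N.
Proof. exact: (ladder_room bounce_gt lad). Qed.
Let zT s : (T <= z s)%N.
Proof. by apply: leq_trans (leq_iter bounce_gt s T); rewrite leq_addr. Qed.

(** A row r that gains a unit satisfies r < T < d(r), which forces l r < k. *)
Lemma cover_weight_le r : cover_weight T a i r <= k%:Z.
Proof.
rewrite /cover_weight; have := lk r.
case: (boolP (T < d r < T + i)%N) => [/andP[Tr rT]|_] /=; last lia.
have := zroom (leq0n a); rewrite /= => room.
have : (r < T)%N by rewrite -bounce_mono; lia.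
rewrite /bounce in Tr rT *; lia.
Qed.

(** The mirror position is x+1 = z_a + i = d(z_a). Only row z_a could start at this column, but its
    part has been lowered, so it starts one column later. *)
Lemma straighten_stop D : (z a + i = z a.+1)%N -> kcat k ell (cover_weight T a i) D = 0.
Proof.
move=> zz; pose x := (z a + i).-1.
have xE : x.+1 = (z a + i)%N by rewrite /x; lia.
have dlast : d x = (z a.+1 + i.-1)%N.
  case: lad => _ _ dz _ _; rewrite (_ : x = (z a + i.-1)%N); last by rewrite /x; lia.
  by apply: dz => //; lia.
have key r : (r < z a)%N -> (d r < z a.+1)%N by rewrite -bounce_mono.
have key2 r : (z a <= r)%N -> (z a.+1 <= d r)%N by rewrite -lt_mono_leq.
have zaT := zT a.
apply: (@kcat_mirror0 _ _ _ x) => [r _|||w _].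
- exact: cover_weight_le.
- by rewrite xE.
- have lx : l x.+1 = l x.
    by move: dlast dzi; rewrite -xE /bounce; have := lk x; have := lk x.+1; lia.
  have dx1 : d x.+1 = (z a.+1 + i)%N by rewrite xE.
  by rewrite /cover_weight lx; lia.
have -> : root_start k (cover_weight T a i) w
   = (d w)%:Z + (z a <= w < z a + i)%N%:R - (T < d w < T + i)%N%:R.
  by rewrite /root_start /cover_weight /bounce; have := lk w; lia.
rewrite xE zz; have := key w; have := key2 w; have := lt_mono_leq (z a + i) w; rewrite dzi.
case: (leqP (z a) w) => [zw h1 /(_ isT) h2 _|zw _ _ /(_ isT)]; last by case: (T < d w < T + i)%N => /=; lia.
have -> : (T < d w < T + i)%N = false by lia.
have zz' : (z a + i)%N = d (z a) := zz.
by rewrite /= in h2 *; move: h1; case: (leqP (z a + i) w) => ww /=; lia.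
Qed.

Hypothesis zi_room : (z a + i < z a.+1)%N.

(* Intermediate weights between the slides of heights i and i+1: the unit lost by
   row z_a+i has been carried up the runner to row z_s+i. *)
Definition walk_weight (s r : nat) : int :=
  cover_weight T a i r - (r == z a + i)%N%:R + (r == z s + i)%N%:R.

Section Level.

Variable s : nat.
Hypothesis sa : (s <= a)%N.
Hypothesis dz : forall s', (s <= s' <= a)%N -> d (z s' + i) = (z s'.+1 + i)%N.
Local Notation w := (z s + i)%N.

Let room : (z s + i < z s.+1)%N.
Proof.
suff H t : (t <= a - s)%N -> (z (a - t) + i < z (a - t).+1)%N.
  by have := H (a - s)%N (leqnn _); rewrite subKn.
elim: t => [|t IH] ta; first by rewrite subn0.
have {IH} IH := IH (ltnW ta).
have E : (a - t = (a - t.+1).+1)%N by lia.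
rewrite E in IH; rewrite ltn_neqAle zroom ?leq_subr // andbT; apply/eqP => e.
have dd : d (z (a - t.+1).+1) = (z (a - t.+1).+1 + i)%N by rewrite -[in LHS]e dz //; lia.
by move: IH; rewrite /= in dd *; rewrite dd ltnn.
Qed.

Let zmono : (z s <= z a)%N.
Proof. by rewrite -(subnK sa) iterD; apply: leq_trans (leq_iter bounce_gt _ _); rewrite leq_addr. Qed.

Let zlt : (s < a)%N -> (z s.+1 <= z a)%N.
Proof. by move=> lt; rewrite -(subnK lt) iterD; apply: leq_trans (leq_iter bounce_gt _ _); rewrite leq_addr. Qed.

(** The changes made to the parts do not affect which row starts at column w, so uniqueness of that
    row reduces to injectivity of d. *)
Let walk_eq r : root_start k (walk_weight s) r = w <-> d r = w.
Proof.
have -> : root_start k (walk_weight s) r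
   = (d r)%:Z + (z a <= r < z a + i)%N%:R - (T < d r < T + i)%N%:R
     + (r == z a + i)%N%:R - (r == w)%:R.
  by rewrite /root_start /walk_weight /cover_weight /bounce; have := lk r; lia.
have TW := zT s; have Ts : (T <= d (z s))%N := zT s.+1.
have dw : d w = (d (z s) + i)%N by apply: dz; rewrite leqnn.
have za : (z a + i < d (z a))%N := zi_room.
have zs : (z s + i < d (z s))%N := room.
case: (leqP (z a) r) => zr /=.
  have dr : (d (z a) <= d r)%N by rewrite lt_mono_leq.
  have -> : (T < d r < T + i)%N = false by have := zT a; lia.
  have [e|ne] := eqVneq s a; first by rewrite e; lia.
  have : (d (z s) <= z a)%N by apply: zlt; lia.
  lia.
have -> : (r == z a + i)%N = false by lia.
have [e|ne] := eqVneq r w; last by case: (boolP (T < d r < T + i)%N) => /=; lia.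
by rewrite e dw; lia.
Qed.

Let walk_le r : walk_weight s r <= k%:Z.
Proof.
have := cover_weight_le r; rewrite /walk_weight.
have dw : d w = (d (z s) + i)%N by apply: dz; rewrite leqnn.
have zs : (z s + i < d (z s))%N := room.
have [e|ne] := eqVneq r w; last by lia.
have lw := lk w; have dw0 := dw; rewrite {1}/bounce in dw0.
have [e'|ne'] := eqVneq s a; first by rewrite e e' eqxx; lia.
have : (d (z s) <= z a)%N by apply: zlt; lia.
have TW := zT s; rewrite /cover_weight e.
have -> : (T < d w < T + i)%N = false by lia.
lia.
Qed.

(** Rows w-1 and w have equal parts because d(w) = d(w-1) + 1. The unit of difference is the carried
    one if s < a; if s = a it comes from the lowering of the rows z_a, ..., z_a+i-1. *)
Let walk_diff : walk_weight s w = walk_weight s w.-1 + 1.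
Proof.
have dw : d w = (d (z s) + i)%N by apply: dz; rewrite leqnn.
have zs : (z s + i < d (z s))%N := room.
have dw1 : d w.-1 = (d (z s) + i.-1)%N.
  case: lad => _ _ dz' _ _; rewrite (_ : w.-1 = (z s + i.-1)%N); last lia.
  by apply: dz' => //; lia.
have lw : l w = l w.-1.
  have e r : d r = (r + k.+1 - l r)%N by [].
  by have := e w; have := e w.-1; rewrite dw dw1; have := lk w; have := lk w.-1; lia.
have TW := zT s; have Ts : (T <= d (z s))%N := zT s.+1.
rewrite /walk_weight /cover_weight lw.
have [e'|ne'] := eqVneq s a; first by rewrite -e' eqxx; lia.
have sz : (d (z s) <= z a)%N by apply: zlt; lia.
have -> : (z a <= w < z a + i)%N = false by lia.
have -> : (z a <= w.-1 < z a + i)%N = false by lia.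
have -> : (T < d w < T + i)%N = false by lia.
have -> : (T < d w.-1 < T + i)%N = false by lia.
have -> : (w == z a + i)%N = false by lia.
have -> : (w.-1 == z a + i)%N = false by lia.
have -> : (w.-1 == w) = false by lia.
by rewrite eqxx /=; lia.
Qed.

Let w_lt : (w.-1.+1 < ell)%N.
Proof. by have := zmono; lia. Qed.

Let w_pred : w.-1.+1 = w. Proof. lia. Qed.

Lemma walk_stop D : (forall v, d v <> w) -> kcat k ell (walk_weight s) D = 0.
Proof.
move=> nv; apply: (kcat_mirror0 _ w_lt) => [r _||v _]; first exact: walk_le.
  by rewrite w_pred walk_diff.
by rewrite w_pred => /walk_eq; apply: nv.
Qed.

Lemma walk_next D v : d v = w ->
  kcat k ell (walk_weight s) D =
  if D is D'.+1
  then kcat k ell (fun r => walk_weight s r + (r == v)%:R - (r == w)%N%:R) D' else 0.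
Proof.
move=> dv; have := @kcat_mirror k ell (walk_weight s) w.-1 (fun r _ => walk_le r) w_lt.
rewrite w_pred => /(_ walk_diff v D); apply.
- by have := bounce_gt v; have := w_lt; rewrite w_pred dv; lia.
- by apply/walk_eq.
by move=> r _ /walk_eq; rewrite -dv; apply: lt_mono_inj.
Qed.

End Level.

(** Each mirror step moves the unit from row z_s + i to the row v with d(v) = z_s + i. For s > 0
    this v is z_(s-1) + i; for s = 0 it is the additional raised row of height i+1. If v is missing,
    the function vanishes and a ladder condition for i+1 fails. *)
Lemma straighten_walk s : (s <= a)%N ->
  (forall s', (s <= s' <= a)%N -> d (z s' + i) = (z s'.+1 + i)%N) ->
  ((forall D, kcat k ell (walk_weight s) D = 0) /\ ~ ladder d T a i.+1) \/
  (ladder d T a i.+1 /\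
   forall D, kcat k ell (walk_weight s) D
             = tpow_mul s.+1 (kcat k ell (cover_weight T a i.+1)) D).
Proof.
elim: s => [|s IH] sa dz.
  have [[v dv]|nv] := classic (exists v, d v = T + i)%N; last first.
    left; split=> [D|lad'].
      by apply: walk_stop => // v dv; apply: nv; exists v.
    by case: lad' => _ _ _ up _; apply: nv; apply: up; rewrite i0 /=.
  right; split.
    case: lad => _ nT dz' up _; split=> //.
    - move=> s' i' s'a; rewrite ltnS leq_eqVlt => /orP[/eqP->|]; first exact: dz.
      exact: dz'.
    - move=> i' /andP[i'0]; rewrite ltnS leq_eqVlt => /orP[/eqP->|i'i]; first by exists v.
      by apply: up; rewrite i'0.
    by rewrite addnS.
  move=> D; rewrite (walk_next sa dz D dv); case: D => // D.
  rewrite tpow_mulS tpow_mul0.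
  apply: (congr1 (fun f : tseries => f D)); apply: eq_kcat => r _.
  have -> : (r == v) = (d r == T + i)%N.
    by apply/eqP/eqP => [->//|dr]; apply: lt_mono_inj; rewrite dr dv.
  by rewrite /walk_weight /cover_weight /=; lia.
have zS : d (z s + i.-1) = (z s.+1 + i.-1)%N.
  by case: lad => _ _ dz' _ _; apply: dz' (ltnW sa) _; lia.
have [[v dv]|nv] := classic (exists v, d v = z s.+1 + i)%N; last first.
  left; split=> [D|lad'].
    by apply: walk_stop => // v dv; apply: nv; exists v.
  by case: lad' => _ _ dz' _ _; apply: nv; exists (z s + i)%N; apply: dz' => //; apply: ltnW.
(* d takes the value just before d(v) at z_s + i - 1, and it is strictly increasing. *)
have vE : v = (z s + i)%N.
  have := bounce_mono (z s + i.-1) v; have := bounce_mono (z s + i)%N v.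
  rewrite dv zS; have := bounce_mono (z s + i.-1) (z s + i)%N; rewrite zS.
  by lia.
have dz' s' : (s <= s' <= a)%N -> d (z s' + i) = (z s'.+1 + i)%N.
  rewrite leq_eqVlt => /andP[/orP[/eqP<- _|ss s'a]]; first by rewrite -vE.
  by apply: dz; rewrite ss.
have next D : kcat k ell (walk_weight s.+1) D.+1 = kcat k ell (walk_weight s) D.
  rewrite (walk_next sa dz _ dv); apply: (congr1 (fun f : tseries => f D)).
  apply: eq_kcat => r _.
  by rewrite /walk_weight vE /=; ring.
have first0 : kcat k ell (walk_weight s.+1) 0 = 0 by rewrite (walk_next sa dz _ dv).
have [[H nlad]|[lad' H]] := IH (ltnW sa) dz'; [left|right].
  split; last exact: nlad.
  by case=> [|D]; [exact: first0|exact: etrans (next D) (H D)].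
split; first exact: lad'.
case=> [|D]; first by rewrite tpow_mulS0; exact: first0.
by rewrite tpow_mulS; exact: etrans (next D) (H D).
Qed.

End Step.

Lemma straighten T a : (forall y, d y <> T) -> (iter a d T < ell)%N ->
  (exists2 h, cover_data d T a h &
     forall D, kcat k ell (fun r => (l r)%:Z - (r == iter a d T)%:R) D
               = tpow_mul (a.+1 * h.-1) (kcat k ell (cover_weight T a h)) D) \/
  ((forall h, ~ cover_data d T a h) /\
   forall D, kcat k ell (fun r => (l r)%:Z - (r == iter a d T)%:R) D = 0).
Proof.
move=> nT; set z := iter a d T => zl.
have dE r : d r = (r + k.+1 - l r)%N by [].
(* If l z = 0, then d(r) = r + k + 1 for all r >= z, so no slide can close, while the lowered weight
   has a negative tail. *)
have [lz|lz] := posnP (l z).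
  right; have l0 r : (z <= r)%N -> l r = 0%N by move=> zr; have := l_noninc zr; lia.
  split=> [h [[h0 _ _ _ _] /(_ (z + h)%N)]|D].
    by rewrite iterS -/z !dE lz l0 ?leq_addr //; lia.
  apply: (@catalan_tail_neg _ _ _ _ z); first exact: Delta_sub.
  rewrite (bigD1 (Ordinal zl)) //= big1 => [|i /andP[zi iz]].
    by rewrite mxE eqxx lz.
  by rewrite mxE l0 // (_ : (i == z :> nat) = false) //; apply: negbTE.
(* The run of rows with the same part as row z ends by row ell, where the parts vanish; its length
   is the only possible height. *)
have hex : exists h, d (z + h) != (d z + h)%N.
  exists (ell - z)%N; rewrite subnKC ?(ltnW zl) // !dE l_supp //; have := lk z; lia.
case: (ex_minnP hex) => h /eqP hne hmin.
have dzi i : (i < h)%N -> d (z + i) = (d z + i)%N.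
  by move=> ih; apply/eqP; apply: contraLR ih => /hmin; rewrite -leqNgt.
have h0 : (0 < h)%N by case: h hne {hmin dzi} => //; rewrite !addn0.
have zi_lt i : (i < h)%N -> (z + i < ell)%N.
  move=> ih; rewrite ltnNge; apply/negP => /l_supp l0.
  by have := dzi i ih; rewrite !dE l0; have := lk z; lia.
have key i : (0 < i <= h)%N ->
   ((forall h, ~ cover_data d T a h) /\
   forall D, kcat k ell (fun r => (l r)%:Z - (r == z)%:R) D = 0) \/
   (ladder d T a i /\ forall D, kcat k ell (fun r => (l r)%:Z - (r == z)%:R) D
               = tpow_mul (a.+1 * i.-1) (kcat k ell (cover_weight T a i)) D).
  elim: i => // -[|i] IH /andP[_ ih].
    right; split.
      split=> // [s i _|i|].
      - by rewrite ltnS leqn0 => /eqP->; rewrite !addn0.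
      - by rewrite ltnS; case: i.
      by rewrite addn1 iterS; apply: bounce_gt.
    move=> D; rewrite muln0 tpow_mul0; apply: (congr1 (fun f : tseries => f D)).
    apply: eq_kcat => r _; rewrite /cover_weight -/z; lia.
  have [stop|[lad H]] := IH (ltnW ih).
    by left.
  have i1h : (i.+1 < h)%N by [].
  (* Heights up to i+1 are barred because d does take the value z_(a+1) + h'; a greater height would
     contain a ladder of height i+2. *)
  have nocov : ~ ladder d T a i.+2 -> forall h', ~ cover_data d T a h'.
    move=> nlad h' [lad' lst]; apply: nlad; apply: (ladder_le lad').
    rewrite /= ltnNge; apply/negP => h'i.
    by apply: (lst (z + h')%N); rewrite iterS -/z dzi //; lia.
  have room : (z + i.+1 <= iter a.+1 d T)%N by case: lad.
  move: room; rewrite leq_eqVlt => /orP[/eqP room|room].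
    left; split.
      by apply: nocov => -[_ _ _ _]; rewrite -/z -room; lia.
    move=> D; rewrite H /tpow_mul; case: ifP => // _.
    by apply: straighten_stop => //; [apply: dzi | apply: zi_lt].
  have E0 D : kcat k ell (cover_weight T a i.+1) D = kcat k ell (walk_weight T a i.+1 a) D.
    apply: (congr1 (fun f : tseries => f D)); apply: eq_kcat => r _.
    by rewrite /walk_weight addrNK.
  have [|[stop nlad]|[lad' E]] := @straighten_walk T a i.+1 lad (dzi _ i1h) (zi_lt _ i1h) room a (leqnn a).
  - move=> s' /andP[h1 h2]; have -> : s' = a by apply/eqP; rewrite eqn_leq h1 h2.
    exact: dzi.
  - left; split; first exact: nocov.
    by move=> D; rewrite H /tpow_mul; case: ifP => // _; rewrite E0 stop.
  right; split; first exact: lad'.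
  move=> D; rewrite H (tpow_mulD _ _ (fun D => etrans (E0 D) (E D))).
  by rewrite /= mulnS addnC.
have [H|[lad H]] := key h (introT andP (conj h0 (leqnn h))); first by right.
left; exists h => //; split=> // y dy.
have e4 : d (z + h.-1) = (d z + h.-1)%N by apply: dzi; lia.
have := bounce_mono (z + h.-1)%N y; have := bounce_mono y (z + h)%N.
have := bounce_mono (z + h.-1)%N (z + h)%N; rewrite dy iterS -/z e4.
have : d (z + h)%N <> (d z + h)%N := hne.
lia.
Qed.

End Straighten.

(** * Runners and their top rows *)

Section Chains.

Variable d : nat -> nat.
Hypothesis dmono : {mono d : r s / (r < s)%N}.
Hypothesis dgt : forall r, (r < d r)%N.

Lemma chain_top z : exists T a, (forall y, d y <> T) /\ iter a d T = z.
Proof.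
have [n] := ubnP z; elim: n z => // n IH z; rewrite ltnS => zn.
have [[y yz]|ny] := classic (exists y, d y = z).
  have [|T [a [nT aT]]] := IH y; first by have := dgt y; rewrite yz; lia.
  by exists T, a.+1; rewrite iterS aT.
by exists z, 0%N; split=> // y yz; apply: ny; exists y.
Qed.

Lemma chain_top_unique T a T' a' : (forall y, d y <> T) -> (forall y, d y <> T') ->
  iter a d T = iter a' d T' -> T = T' /\ a = a'.
Proof.
move=> nT nT'; elim: a a' => [|a IH] [|a'] //=.
- by move=> e; case: (nT (iter a' d T')).
- by move=> e; case: (nT' (iter a d T)).
by move/(lt_mono_inj dmono)/IH => -[-> ->].
Qed.

Lemma cover_data_height T a h h' : cover_data d T a h -> cover_data d T a h' -> h = h'.
Proof.
move=> [[h0 _ dz _ _] lst] [[h'0 _ dz' _ _] lst'].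
have [lt|lt|//] := ltngtP h h'.
  by case: (lst (iter a d T + h)%N); apply: dz'.
by case: (lst' (iter a d T + h')%N); apply: dz.
Qed.

End Chains.

(** * Expansion of the lowered Catalan function *)

Section Expansion.

Variables (k ell : nat) (l : nat -> nat).
Hypothesis lk : forall r, (l r <= k)%N.
Hypothesis l_noninc : forall r s, (r <= s)%N -> (l s <= l r)%N.
Hypothesis l_supp : forall r, (ell <= r)%N -> l r = 0%N.
Local Notation d := (bounce k l).
Let dgt := bounce_gt lk.
Let dmono := bounce_mono lk l_noninc.

Definition lowered_catalan (m : nat) : tseries :=
  catalan (Delta k (\row_(i < ell) (l i)%:Z)) (\row_(i < ell) ((l i)%:Z - (i == m :> nat)%:R)).

Lemma root_start_bounce r : root_start k (fun r => (l r)%:Z) r = (d r)%:Z.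
Proof. by rewrite /root_start /bounce; have := lk r; lia. Qed.

(** The removed root is (m, d(m)), the first of its row: without it the roots are those of lambda -
    e_m, whose row m starts one column later. If d(m) >= ell there is no such root. *)
Lemma lowered_catalan_rec m D : (m < ell)%N ->
  lowered_catalan m D =
  kcat k ell (fun r => (l r)%:Z - (r == m)%:R) D
  + (if D is D'.+1 then if (d m < ell)%N then lowered_catalan (d m) D' else 0 else 0).
Proof.
move=> ml; set g := fun r => _; rewrite /lowered_catalan -/(kcat _ _ _).
have lk' r : (r < ell)%N -> (l r)%:Z <= k%:Z by move=> _; have := lk r; lia.
have gk r : (r < ell)%N -> g r <= k%:Z by move=> _; rewrite /g; have := lk r; lia.
have gE r : root_start k g r = (d r)%:Z + (r == m)%:R.
  by rewrite /g -root_start_bounce /root_start; ring.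
have memD (i j : 'I_ell) : ((i, j) \in Delta k (\row_(i < ell) (l i)%:Z)) = (d i <= j)%N.
  by rewrite (mem_Delta (g := fun r => (l r)%:Z)) // root_start_bounce lez_nat.
have memg (i j : 'I_ell) :
    ((i, j) \in Delta k (\row_(i < ell) g i)) = ((d i)%:Z + (i == m :> nat)%:R <= j%:Z).
  by rewrite mem_Delta // gE.
rewrite /kcat; case: (ltnP (d m) ell) => dm; last first.
  have -> : Delta k (\row_(i < ell) g i) = Delta k (\row_(i < ell) (l i)%:Z).
    apply: roots_ext => -[i il] [j jl]; rewrite memD memg /=.
    by case: (eqVneq i m) => [->|_] /=; lia.
  by case: D => [|D]; rewrite addr0.
pose b : 'I_ell * 'I_ell := (Ordinal ml, Ordinal dm).
have bP : b \in Delta k (\row_(i < ell) (l i)%:Z) by rewrite memD /=.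
rewrite (catalan_remove _ _ bP).
have -> : Delta k (\row_(i < ell) (l i)%:Z) :\ b = Delta k (\row_(i < ell) g i).
  apply: roots_ext => -[i il] [j jl].
  rewrite in_setD1 xpair_eqE -!val_eqE memD memg /=.
  by case: (eqVneq i m) => [->|_] /=; lia.
have -> // : \row_(i < ell) ((l i)%:Z - (i == m :> nat)%:R) + (eps b.1 - eps b.2)
          = \row_(i < ell) ((l i)%:Z - (i == d m :> nat)%:R).
by apply/rowP=> i; rewrite !mxE -!val_eqE /=; ring.
Qed.

(** A tuple (r, T, a, h) records a slide whose last row is reached from m in r steps of d. For each
    r there is at most one, because a row determines its runner and the height is forced. *)
Lemma lowered_catalan_expand m : (m < ell)%N ->
  exists Z : seq (nat * nat * nat * nat),
  [/\ uniq Z,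
      forall r T a h, (r, T, a, h) \in Z <->
        [/\ cover_data d T a h, iter a d T = iter r d m & (iter r d m < ell)%N]
    & forall D, lowered_catalan m D =
        \sum_(q <- Z) tpow_mul (q.1.1.1 + q.1.2.+1 * q.2.-1)
                               (kcat k ell (cover_weight k l q.1.1.2 q.1.2 q.2)) D].
Proof.
have [n] := ubnP (ell - m); elim: n m => // n IH m; rewrite ltnS => mn ml.
have {IH} [Z [uZ ZP ZE]] : exists Z : seq (nat * nat * nat * nat),
  [/\ uniq Z,
      forall r T a h, (r, T, a, h) \in Z <->
        [/\ cover_data d T a h, iter a d T = iter r.+1 d m & (iter r.+1 d m < ell)%N]
    & forall D, (if (d m < ell)%N then lowered_catalan (d m) D else 0) =
        \sum_(q <- Z) tpow_mul (q.1.1.1 + q.1.2.+1 * q.2.-1)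
                               (kcat k ell (cover_weight k l q.1.1.2 q.1.2 q.2)) D].
  case: (ltnP (d m) ell) => dm.
    have [|Z [uZ ZP ZE]] := IH _ _ dm; first by have := dgt m; lia.
    by exists Z; split=> // r T a h; rewrite ZP iterSr.
  exists [::]; split=> // [r T a h|D]; last by rewrite big_nil.
  split=> // -[_ _ lt]; have : (iter r.+1 d m < ell)%N by [].
  rewrite iterSr ltnNge (leq_trans dm) //.
  by apply: leq_trans (leq_iter dgt r (d m)); rewrite leq_addr.
pose Z' := [seq (q.1.1.1.+1, q.1.1.2, q.1.2, q.2) | q <- Z].
have mapinj : injective (fun q : nat * nat * nat * nat => (q.1.1.1.+1, q.1.1.2, q.1.2, q.2)).
  by move=> [[[r T] a] h] [[[r' T'] a'] h'] /= [-> -> -> ->].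
have uZ' : uniq Z' by rewrite map_inj_uniq.
have Z'0 T a h : (0%N, T, a, h) \notin Z' by apply/mapP=> -[q _] [].
have Z'S r T a h : (r.+1, T, a, h) \in Z' <->
        [/\ cover_data d T a h, iter a d T = iter r.+1 d m & (iter r.+1 d m < ell)%N].
  by rewrite -ZP (mem_map mapinj Z (r, T, a, h)).
have Z'E D : (if D is D'.+1 then if (d m < ell)%N then lowered_catalan (d m) D' else 0 else 0) =
        \sum_(q <- Z') tpow_mul (q.1.1.1 + q.1.2.+1 * q.2.-1)
                               (kcat k ell (cover_weight k l q.1.1.2 q.1.2 q.2)) D.
  rewrite big_map; case: D => [|D].
    by rewrite big1 // => q _; rewrite /= addSn tpow_mulS0.
  by rewrite ZE; apply: eq_bigr => q _; rewrite /= addSn tpow_mulS.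
have [T [a [nT aT]]] := chain_top dgt m.
have Tl : (iter a d T < ell)%N by rewrite aT.
have [[h cov E]|[ncov E]] := straighten lk l_noninc l_supp nT Tl.
  exists ((0%N, T, a, h) :: Z'); split.
  - by rewrite /= Z'0.
  - move=> [|r] T' a' h'; rewrite in_cons; last first.
      by rewrite -Z'S; split=> [/orP[/eqP|]|->]; rewrite ?orbT.
    rewrite (negPf (Z'0 _ _ _)) orbF; split=> [/eqP[-> -> ->] //|/= [cov' e _]].
    have [eT ea] := chain_top_unique dmono (let: And5 _ n _ _ _ := cov'.1 in n) nT (etrans e (esym aT)).
    by rewrite eT ea in cov' *; rewrite (cover_data_height cov' cov).
  - move=> D; rewrite lowered_catalan_rec // Z'E big_cons /= add0n; congr (_ + _).
    by rewrite -E aT.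
exists Z'; split=> // [[|r] T' a' h'|D]; first last.
- rewrite lowered_catalan_rec // Z'E -[RHS]add0r; congr (_ + _).
  by rewrite -(E D) aT.
- exact: Z'S.
rewrite (negPf (Z'0 _ _ _)); split=> // /= [[cov' e _]].
have [eT ea] := chain_top_unique dmono (let: And5 _ n _ _ _ := cov'.1 in n) nT (etrans e (esym aT)).
by case: (ncov h'); rewrite -eT -ea.
Qed.

End Expansion.

(** * Strong covers *)

Section Cover.

Variables (k : nat) (s : seq nat).
Hypothesis cs : is_core k s.
Local Notation l := (part_of k s).
Local Notation d := (bounce k l).
Local Notation b := (bead s).
Variables (T a h : nat).
Hypothesis cov : cover_data d T a h.
Local Notation z i := (iter i d T).

Let ps : is_partition s. Proof. by case: cs. Qed.
Let lad : ladder d T a h. Proof. by case: cov. Qed.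
Let dgt : forall r, (r < d r)%N := bounce_gt (core_part_le cs).
Let dmono : {mono d : r r' / (r < r')%N} :=
  bounce_mono (core_part_le cs) (core_part_noninc cs).
Let h0 : (0 < h)%N. Proof. by case: lad. Qed.
Let nT y : d y <> T. Proof. by case: lad => _ nT _ _ _; apply: nT. Qed.
Let dz i j : (i <= a)%N -> (j < h)%N -> d (z i + j)%N = (z i.+1 + j)%N.
Proof. by case: lad => _ _ dz _ _; apply: dz. Qed.
Let bd r : b (d r) = b r - k.+1%:Z := bead_bounce cs r.
Let blt r r' : (b r' < b r) = (r < r')%N := bead_lt r r' ps.
Let ble r r' : (b r' <= b r) = (r <= r')%N.
Proof. by rewrite leNgt blt -leqNgt. Qed.

Lemma block_lt i i' : (i < i')%N -> (i' <= a.+1)%N -> (z i + h <= z i')%N.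
Proof.
move=> ii' i'a; apply: leq_trans (ladder_room dgt lad (_ : i <= a)%N) _; first lia.
rewrite -(subnK ii') iterD; apply: leq_trans (leq_iter dgt _ _); exact: leq_addr.
Qed.

Lemma block_inj i i' j j' : (i <= a)%N -> (i' <= a)%N -> (j < h)%N -> (j' < h)%N ->
  (z i + j = z i' + j')%N -> i = i' /\ j = j'.
Proof.
move=> ia i'a jh j'h e; have [lt|lt|ii'] := ltngtP i i'.
- by have := block_lt lt (leqW i'a); lia.
- by have := block_lt lt (leqW ia); lia.
by split=> //; move: e; rewrite ii' => /addnI.
Qed.

(* The bead of the row that becomes last in each block moves down by this amount. *)
Definition cover_shift : int := b (z a.+1) - b (z a.+1 + h)%N.

(** The slid bead fits between the beads of rows z_i + h - 1 and z_i + h. At i = a the lower bound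
    is strict because d skips z_(a+1) + h; smaller i follow by translation along the runner. *)
Lemma cover_shift_bounds i : (i <= a)%N ->
  b (z i + h)%N < b (z i) - cover_shift < b (z i + h.-1)%N.
Proof.
move=> ia; rewrite -(subKn ia); move: (a - i)%N (leq_subr i a) => t.
elim: t => [|t IH] ta.
  rewrite subn0 /cover_shift.
  have e1 := bd (z a); have e2 := bd (z a + h)%N; have e3 := bd (z a + h.-1)%N.
  have e4 : d (z a + h.-1)%N = (d (z a) + h.-1)%N by apply: dz => //; lia.
  have lt : (d (z a) + h < d (z a + h))%N.
    rewrite ltn_neqAle; apply/andP; split; first by apply/eqP => e; case: cov => _ /(_ (z a + h)%N) [].
    by have := dmono (z a + h.-1)%N (z a + h)%N; rewrite e4; lia.
  move: lt; rewrite -blt; have : b (d (z a) + h)%N < b (d (z a) + h.-1)%N by rewrite blt; lia.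
  by rewrite -e4 /=; lia.
have {IH} := IH (ltnW ta); rewrite (_ : (a - t = (a - t.+1).+1)%N); last lia.
set i0 := (a - t.+1)%N; have i0a : (i0 <= a)%N by apply: leq_subr.
have e1 := bd (z i0); have e2 := bd (z i0 + h)%N; have e3 := bd (z i0 + h.-1)%N.
have e4 : d (z i0 + h.-1)%N = (d (z i0) + h.-1)%N by apply: dz => //; lia.
have le : (d (z i0) + h <= d (z i0 + h))%N.
  by have := dmono (z i0 + h.-1)%N (z i0 + h)%N; rewrite e4; lia.
by move: le; rewrite -ble -e4 /=; lia.
Qed.

Definition in_block (r : nat) : bool :=
  has (fun i => z i <= r < z i + h)%N (iota 0 a.+1).

Definition block_end (r : nat) : bool :=
  has (fun i => r.+1 == z i + h)%N (iota 0 a.+1).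

(** The beads sorted again after the slide: in each block the slid bead becomes the last one, and
    the others move up by one row. *)
Definition cover_bead (r : nat) : int :=
  if block_end r then b (r.+1 - h)%N - cover_shift
  else if in_block r then b r.+1 else b r.

Lemma in_blockP r : reflect (exists i j, [/\ (i <= a)%N, (j < h)%N & r = (z i + j)%N]) (in_block r).
Proof.
apply: (iffP hasP) => [[i]|[i [j [ia jh ->]]]].
  rewrite mem_iota => /andP[_ ia] /andP[zr rz]; exists i, (r - z i)%N.
  by split; lia.
by exists i; rewrite ?mem_iota //=; lia.
Qed.

Lemma block_endE i j : (i <= a)%N -> (j < h)%N -> block_end (z i + j) = (j.+1 == h).
Proof.
move=> ia jh; apply/hasP/eqP => [[i']|jE].
  rewrite mem_iota => /andP[_ i'a] /eqP e.
  have [||_ ->] := block_inj ia (i'a : i' <= a)%N jh (_ : h.-1 < h)%N; lia.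
by exists i; rewrite ?mem_iota //= -jE addnS.
Qed.

Lemma cover_bead_block i j : (i <= a)%N -> (j < h)%N ->
  cover_bead (z i + j) = if j.+1 == h then b (z i) - cover_shift else b (z i + j).+1.
Proof.
move=> ia jh; rewrite /cover_bead block_endE //; case: eqP => [<-|_].
  by rewrite -addnS addnK.
by have -> : in_block (z i + j) by apply/in_blockP; exists i, j.
Qed.

Lemma cover_bead_out r : ~~ in_block r -> cover_bead r = b r.
Proof.
move=> nb; rewrite /cover_bead (negPf nb); case: ifP => // /hasP[i].
rewrite mem_iota => /andP[_ ia] /eqP e; case/negP: nb; apply/in_blockP; exists i, h.-1.
by split; lia.
Qed.

Lemma cover_bead_le r : cover_bead r <= b r ?= iff ~~ in_block r.
Proof.
case: (boolP (in_block r)) => [/in_blockP[i [j [ia jh ->]]]|nb]; last first.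
  by rewrite cover_bead_out //; split; rewrite ?lexx ?eqxx.
have lt : cover_bead (z i + j) < b (z i + j)%N.
  rewrite cover_bead_block //; case: eqP => [jE|_]; last by rewrite blt.
  by have /andP[_] := cover_shift_bounds ia; rewrite -jE.
by split; [apply: ltW | rewrite lt_eqF].
Qed.

(* Rows r and r+1 of the skew shape share a column exactly when both lie in the
   same block. *)
Lemma cover_bead_link r : (cover_bead r <= b r.+1) = in_block r && ~~ block_end r.
Proof.
case: (boolP (in_block r)) => [/in_blockP[i [j [ia jh ->]]]|nb]; last first.
  by rewrite cover_bead_out // leNgt blt ltnSn.
rewrite block_endE // cover_bead_block //; case: eqP => [jE|_]; last by rewrite lexx.
apply/negbTE; rewrite -ltNge; have /andP[] := cover_shift_bounds ia.
by rewrite -jE addnS.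
Qed.

Lemma cover_bead_lt r : cover_bead r.+1 < cover_bead r.
Proof.
have [le _] := cover_bead_le r.+1.
case: (boolP (in_block r)) => [/in_blockP[i [j [ia jh rE]]]|nb]; last first.
  by rewrite (cover_bead_out nb); apply: le_lt_trans le _; rewrite blt.
rewrite {2}rE cover_bead_block //; case: eqP => [jE|jE].
  apply: le_lt_trans le _; have /andP[lt _] := cover_shift_bounds ia.
  by rewrite rE -addnS jE.
rewrite rE -addnS cover_bead_block //; last lia.
case: eqP => [jE'|_]; last by rewrite blt.
by have /andP[_] := cover_shift_bounds ia; rewrite -jE'.
Qed.

Let zT_room i : (T + h <= z i.+1)%N.
Proof.
apply: leq_trans (ladder_room dgt lad (leq0n a)) _.
by rewrite [X in (_ <= X)%N]iterSr; apply: leq_trans (leq_iter dgt _ _); rewrite leq_addr.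
Qed.

Let z_le i : (i <= a)%N -> (z i <= z a)%N.
Proof.
by move=> ia; rewrite -(subnK ia) iterD; apply: leq_trans (leq_iter dgt _ _); rewrite leq_addr.
Qed.

(** The row j of the bead k+1 positions lower gives the new part r + k + 1 - j. It is d(r) + 1 for r
    in the last block, whose targets lie outside all blocks, d(r) - 1 if d(r) is a row of the first
    block other than T, and d(r) otherwise. *)
Lemma cover_bead_next r : exists2 j, cover_bead j = cover_bead r - k.+1%:Z &
  j%:Z = r%:Z + k.+1%:Z - cover_weight k l T a h r.
Proof.
have dE r' : d r' = (r' + k.+1 - l r')%N by [].
have lk r' : (l r' <= k)%N := core_part_le cs r'.
have cwE : r%:Z + k.+1%:Z - cover_weight k l T a h r =
    (d r)%:Z + (z a <= r < z a + h)%N%:R - (T < d r < T + h)%N%:R.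
  by rewrite /cover_weight; have := dE r; have := lk r; lia.
rewrite cwE.
case: (boolP (in_block r)) => [/in_blockP[i [j [ia jh rE]]]|nb].
  have dr : d r = (z i.+1 + j)%N by rewrite rE dz.
  have -> : (T < d r < T + h)%N = false by have := zT_room i; rewrite dr; lia.
  move: ia; rewrite leq_eqVlt => /orP[/eqP ia|ia].
    have -> : (z a <= r < z a + h)%N = true by rewrite rE ia; lia.
    exists (d r).+1; last by rewrite /=; lia.
    have out : ~~ in_block (d r).+1.
      apply/in_blockP=> -[i' [j' [i'a j'h e]]].
      have := ladder_room dgt lad (leqnn a); have := z_le i'a; rewrite dr ia in e; lia.
    rewrite cover_bead_out // rE ia cover_bead_block // dz //.
    case: eqP => [jh'|jh'].
      by rewrite -addnS jh' /cover_shift /= bd; lia.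
    by rewrite -bd -addnS -[(z a + j).+1]addnS dz //; lia.
  have -> : (z a <= r < z a + h)%N = false.
    by rewrite rE; have := block_lt ia (leqnSn a); lia.
  exists (d r); last by rewrite /=; lia.
  rewrite dr rE !cover_bead_block // ?(ltnW ia) //.
  case: eqP => [_|jh']; first by rewrite /= bd; lia.
  by rewrite -bd -!addnS dz //; lia.
have -> : (z a <= r < z a + h)%N = false.
  by apply/negP => zr; case/negP: nb; apply/in_blockP; exists a, (r - z a)%N; split; lia.
rewrite (cover_bead_out nb).
case: (boolP (T < d r < T + h)%N) => [Tdr|ndr].
  exists (d r).-1; last by rewrite /=; lia.
  have -> : (d r).-1 = (z 0 + (d r - T).-1)%N by rewrite /=; lia.
  rewrite cover_bead_block //; last lia.
  by case: eqP => [|_]; [lia|rewrite -bd /=; congr b; lia].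
exists (d r); last by rewrite /=; lia.
rewrite -bd cover_bead_out //; apply/in_blockP => -[i [j [ia jh e]]].
case: i ia e => [|i] ia /= e.
  by case: (posnP j) => j0; [apply: (nT (y := r)); lia|move: ndr; lia].
case/negP: nb; apply/in_blockP; exists i, j; split=> //; first exact: ltnW.
by apply: (lt_mono_inj dmono); rewrite e dz // ltnW.
Qed.

Lemma cover_bead_supp r : (size s <= r)%N -> (z a + h <= r)%N -> cover_bead r = - r%:Z.
Proof.
move=> sr zr; rewrite cover_bead_out; first by rewrite /bead nth_default // sub0r.
by apply/in_blockP => -[i [j [ia jh e]]]; have := z_le ia; lia.
Qed.

Lemma cover_core : exists2 t, is_core k t &
  (forall r, bead t r = cover_bead r) /\
  (forall r, (part_of k t r)%:Z = cover_weight k l T a h r).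
Proof.
have mono r r' : (r <= r')%N -> cover_bead r' + r'%:Z <= cover_bead r + r%:Z.
  move/subnKC <-; elim: (r' - r)%N => [|n IH]; first by rewrite addn0.
  by apply: le_trans IH; rewrite addnS; have := cover_bead_lt (r + n); lia.
have ge0 r : 0 <= cover_bead r + r%:Z.
  have := mono r (r + (size s + (z a + h)))%N (leq_addr _ _).
  by rewrite cover_bead_supp; lia.
pose S r := absz (cover_bead r + r%:Z).
have SE r : (S r)%:Z = cover_bead r + r%:Z by rewrite /S; have := ge0 r; lia.
have [||t pt tE] := @partition_of_fun S (size s + (z a + h)).
- by move=> r r' /mono; have := SE r; have := SE r'; lia.
- by move=> r rL; have := SE r; rewrite cover_bead_supp; lia.
have bE r : bead t r = cover_bead r by rewrite /bead tE SE addrK.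
have ct : is_core k t.
  apply: bead_closed_core => // r; have [j jE _] := cover_bead_next r.
  by exists j; rewrite !bE.
exists t => //; split=> // r; have [j jE jw] := cover_bead_next r.
have jE' : bead t j = bead t r - k.+1%:Z by rewrite !bE.
rewrite (nth_core_part pt jE'); move: jE' jw (bead_lt r j pt).
by have := @partition_nth_le t r j pt; rewrite /bead; lia.
Qed.

(** Exactly h rows lose a unit, and h - 1 rows gain one, since T+1, ..., T+h-1 are all values of the
    injective map d. *)
Lemma cover_size t : is_core k t ->
  (forall r, (part_of k t r)%:Z = cover_weight k l T a h r) ->
  (sumn (core_part k t) + 1 = sumn (core_part k s))%N.
Proof.
move=> ct tE; pose L := (size s + size t + (z a + h))%N.
have [sL tL] : (size s <= L)%N /\ (size t <= L)%N by rewrite /L; lia.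
rewrite (sumn_core_part k sL) (sumn_core_part k tL); have Tz : (T <= z a)%N := z_le (leq0n a).
have e1 : (\sum_(r < L) (z a <= r < z a + h) = h)%N.
  have : (h <= h)%N by []; move: {1 3 4}h => j; elim: j => [|j IH] jh.
    by rewrite big1 // => r _; lia.
  have yL : (z a + j < L)%N by rewrite /L; lia.
  rewrite -[RHS]addn1 -{2}(IH (ltnW jh)).
  rewrite (eq_bigr (fun r : 'I_L => (z a <= r < z a + j) + (r == Ordinal yL))%N).
    by rewrite big_split /= -(big_mkcond (fun r => r == Ordinal yL)) big_pred1_eq.
  by move=> r _; rewrite -val_eqE /=; lia.
have e2 j : (j < h)%N -> (\sum_(r < L) (T < d r < T + j.+1) = j)%N.
  elim: j => [|j IH] jh.
    by rewrite big1 // => r _; lia.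
  have [y yE] : exists y, d y = (T + j.+1)%N.
    by case: lad => _ _ _ up _; apply: up; rewrite jh.
  have yL : (y < L)%N by have := dgt y; rewrite /L; lia.
  rewrite -[RHS]addn1 -{2}(IH (ltnW jh)).
  rewrite (eq_bigr (fun r : 'I_L => (T < d r < T + j.+1) + (r == Ordinal yL))%N).
    by rewrite big_split /= -(big_mkcond (fun r => r == Ordinal yL)) big_pred1_eq.
  move=> r _; have -> : (r == Ordinal yL) = (d r == T + j.+1)%N.
    by rewrite -val_eqE /= -yE; apply/eqP/eqP => [->|/(lt_mono_inj dmono)].
  lia.
have {}e2 : (\sum_(r < L) (T < d r < T + h) = h.-1)%N.
  by rewrite -(e2 h.-1) ?prednK.
have E : (\sum_(r < L) (part_of k t r + (z a <= r < z a + h)) =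
          \sum_(r < L) (l r + (T < d r < T + h)))%N.
  by apply: eq_bigr => r _; have := tE r; rewrite /cover_weight; lia.
by move: E; rewrite !big_split /= e1 e2; lia.
Qed.

End Cover.

Lemma int_max_ex (Q : int -> Prop) (x0 H : int) : Q x0 -> (forall x : int, H <= x -> ~ Q x) ->
  exists2 P, Q P & forall x : int, P < x -> ~ Q x.
Proof.
move=> Q0 QH; have [n] := ubnP `|H - x0|%N; elim: n x0 Q0 => // n IH x0 Q0; rewrite ltnS => le.
have [[x [lt Qx]]|nex] := classic (exists x, x0 < x /\ Q x); last first.
  by exists x0 => // x lt Qx; apply: nex; exists x.
apply: (IH x Qx); have : ~ (H <= x) by move=> /QH.
lia.
Qed.

(** * Comparing bead counts of two nested cores *)

Section Profiles.

(* Number of beads in positions at least x, for two bead configurations closed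
   under moving a bead down by n. *)
Variables (n : nat) (NK NT : int -> int).
Hypothesis n0 : (0 < n)%N.
Local Notation K x := (NK x = NK (x + 1) + 1).
Hypothesis stepK : forall x : int, NK (x + 1) <= NK x <= NK (x + 1) + 1.
Hypothesis stepT : forall x : int, NT (x + 1) <= NT x <= NT (x + 1) + 1.
Hypothesis coreK : forall x, NK x - NK (x + 1) <= NK (x - n%:Z) - NK (x - n%:Z + 1).
Hypothesis coreT : forall x, NT x - NT (x + 1) <= NT (x - n%:Z) - NT (x - n%:Z + 1).
Hypothesis leTK : forall x, NT x <= NK x.
Local Notation D x := (NK x - NT x).

Lemma profile_bead_down x m : K x -> K (x - m%:Z * n%:Z).
Proof.
elim: m => [|m IH] Kx; first by rewrite mul0r subr0.
have := coreK (x - m%:Z * n%:Z); have := IH Kx; have := stepK (x - m.+1%:Z * n%:Z).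
have -> : x - m%:Z * n%:Z - n%:Z = x - m.+1%:Z * n%:Z by lia.
lia.
Qed.

(* The beads p, p+n, ..., p+(j-1)n of K can all move down by p-g without violating
   [NT <= NK]. *)
Definition candidate (p g : int) (j : nat) : Prop :=
  [/\ (0 < j)%N, forall s, (s < j)%N -> K (p + s%:Z * n%:Z), ~ K (p + j%:Z * n%:Z),
      [/\ g < p, ~ K g & K (g - n%:Z)]
    & forall s x, (s < j)%N -> g + s%:Z * n%:Z < x <= p + s%:Z * n%:Z -> 0 < D x].

(* P is the highest position where the profiles differ. Without a candidate starting
   at P - a*n, the gaps of K in the window [g, P) - a*n stay gaps n positions lower, so
   that D stays positive at P - (a+1)*n; but far down there are no gaps. *)
Lemma candidate_ex (x0 Hi Lo : int) : 0 < D x0 -> (forall x : int, Hi <= x -> D x = 0) ->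
  (forall x : int, x <= Lo -> D x = 0 /\ K x) -> exists p g j, candidate p g j.
Proof.
move=> D0 DHi DLo; apply: NNPP => nocand.
have [P DP Pmax] : exists2 P, 0 < D P & forall x, P < x -> ~ 0 < D x.
  by apply: (int_max_ex D0) => x /DHi->.
have KP : K P by have := Pmax (P + 1); have := stepK P; have := stepT P; have := leTK (P + 1); lia.
have nKP : ~ K (P + n%:Z).
  move=> KPn; have := coreT (P + n%:Z); rewrite addrK.
  have := Pmax (P + 1); have := Pmax (P + n%:Z); have := Pmax (P + n%:Z + 1).
  have := leTK (P + 1); have := leTK (P + n%:Z); have := leTK (P + n%:Z + 1).
  by have := stepT P; lia.
have [g0 [g0P Dg0] g0max] : exists2 g, g < P /\ D g = 0 & forall x, g < x -> ~ (x < P /\ D x = 0).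
  apply: (@int_max_ex (fun g => g < P /\ D g = 0) (Num.min Lo (P - 1)) P) => [|x Px []]; last lia.
  by split; [lia|have [] := DLo (Num.min Lo (P - 1)); lia].
have inv a : exists2 g, g0 <= g < P & [/\ forall b x, (b <= a)%N ->
      g - b%:Z * n%:Z < x <= P - b%:Z * n%:Z -> 0 < D x, ~ K (g - a%:Z * n%:Z) &
      1 <= D (P - a%:Z * n%:Z) - D (g - a%:Z * n%:Z)].
  elim: a => [|a [g gP [Dpos nK Dgap]]].
    exists g0; first by rewrite lexx g0P.
    rewrite !mul0r !subr0; split; last lia.
      move=> b x; rewrite leqn0 => /eqP->; rewrite mul0r !subr0 => /andP[gx xP].
      have := g0max x gx; have := leTK x.
      have [->|ne] := eqVneq x P; first by [].
      have : x < P by rewrite lt_neqAle ne.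
      by case: (eqVneq (D x) 0) => [->|ne0] xP' le; [case|move=> _; lia].
    have := g0max (g0 + 1); have := stepK g0; have := stepT g0; have := leTK (g0 + 1).
    have [e|ne] := eqVneq (g0 + 1) P; first by rewrite e; lia.
    by lia.
  have same x : g <= x < P -> ~ K (x - a%:Z * n%:Z) -> ~ K (x - a.+1%:Z * n%:Z).
    move=> gxP nKx Kx; apply: nocand; exists (P - a%:Z * n%:Z), (x - a%:Z * n%:Z), a.+1.
    split=> // [s sa||| s y sa ylt].
    - have := profile_bead_down (a - s)%N KP.
      by rewrite (_ : P - (a - s)%N%:Z * n%:Z = P - a%:Z * n%:Z + s%:Z * n%:Z); last nia.
    - by rewrite (_ : P - a%:Z * n%:Z + a.+1%:Z * n%:Z = P + n%:Z); last lia.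
    - split=> //; first lia.
      by rewrite (_ : x - a%:Z * n%:Z - n%:Z = x - a.+1%:Z * n%:Z); last lia.
    by apply: (Dpos (a - s)%N); first lia; nia.
  have tele m : g + m%:Z <= P ->
      D (P - a%:Z * n%:Z) - D (P - m%:Z - a%:Z * n%:Z)
      <= D (P - a.+1%:Z * n%:Z) - D (P - m%:Z - a.+1%:Z * n%:Z).
    elim: m => [|m IH] mP; first by rewrite !subr0 !subrr.
    have := IH ltac:(lia); set x := P - m.+1%:Z.
    have -> : P - m%:Z = x + 1 by rewrite /x; lia.
    have := same x; have := coreK (x - a%:Z * n%:Z); have := coreT (x - a%:Z * n%:Z).
    have := stepK (x - a%:Z * n%:Z); have := stepK (x - a.+1%:Z * n%:Z).
    have -> : x - a%:Z * n%:Z - n%:Z = x - a.+1%:Z * n%:Z by lia.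
    have -> : x + 1 - a%:Z * n%:Z = x - a%:Z * n%:Z + 1 by lia.
    have -> : x + 1 - a.+1%:Z * n%:Z = x - a.+1%:Z * n%:Z + 1 by lia.
    have : g <= x < P by rewrite /x; lia.
    by move=> gx; rewrite gx; lia.
  have Dgap' : 1 <= D (P - a.+1%:Z * n%:Z) - D (g - a.+1%:Z * n%:Z).
    have := tele `|P - g|%N; rewrite (_ : P - `|P - g|%N%:Z = g); lia.
  have [g' [gg' g'P Dg'] g'max] : exists2 g', [/\ g <= g', g' < P &
      g' = g \/ D (g' - a.+1%:Z * n%:Z) = 0] &
      forall x, g' < x -> ~ [/\ g <= x, x < P & x = g \/ D (x - a.+1%:Z * n%:Z) = 0].
    apply: (@int_max_ex (fun g' => [/\ g <= g', g' < P &
      g' = g \/ D (g' - a.+1%:Z * n%:Z) = 0]) g P) => [|x Px []]; last lia.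
    by split; [|lia|left].
  have DP1 : 1 <= D (P - a.+1%:Z * n%:Z) by have := leTK (g - a.+1%:Z * n%:Z); lia.
  have g'pos x : g' < x -> x <= P -> 0 < D (x - a.+1%:Z * n%:Z).
    move=> g'x; rewrite le_eqVlt => /orP[/eqP->|xP]; first lia.
    rewrite lt_neqAle subr_ge0 leTK andbT; apply/eqP => e.
    by apply: (g'max x g'x); split; [lia|by []|right].
  exists g'; first lia.
  split.
  - move=> b x ba xb; have [lt|ge] := ltnP b a.+1.
      by apply: (Dpos b) => //; lia.
    have eb : b = a.+1 by lia.
    rewrite eb in xb; have := g'pos (x + a.+1%:Z * n%:Z); rewrite addrK; apply; lia.
  - case: Dg' => [->|Dg']; first by apply: same => //; lia.
    have := g'pos (g' + 1); rewrite (_ : g' + 1 - a.+1%:Z * n%:Z = g' - a.+1%:Z * n%:Z + 1); last lia.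
    have := stepT (g' - a.+1%:Z * n%:Z); lia.
  by case: Dg' => [->|->] //; lia.
have [g gP [_ nK _]] := inv `|P - Lo|%N.
by apply: nK; apply: (proj2 (DLo _ _)); nia.
Qed.

(** A candidate with p - g minimal works: if g <= p - n, then p - n can replace p, and an interior x
    violating the conclusion can replace p or g. *)
Lemma candidate_min p g j : candidate p g j -> exists p' g' j',
  [/\ candidate p' g' j', p' - n%:Z < g' &
      forall x : int, g' < x < p' -> K (x - n%:Z) -> forall s, (s <= j')%N -> K (x + s%:Z * n%:Z)].
Proof.
have [m] := ubnP `|p - g|%N; elim: m p g j => // m IH p g j; rewrite ltnS => le cand.
have [j0 Kp nKp [gp nKg Kg] Dpos] := cand.
have Kp0 : K p by have := Kp 0%N j0; rewrite mul0r addr0.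
have [gpn|gpn] := ltP (p - n%:Z) g; last first.
  have Kpn : K (p - n%:Z) by have := profile_bead_down 1 Kp0; rewrite mul1r.
  have lt : g < p - n%:Z.
    rewrite lt_neqAle gpn andbT; apply/eqP => e; apply: nKg; rewrite e; exact: Kpn.
  apply: (IH (p - n%:Z) g j.+1); first lia.
  split=> // [[|s] sj||s x sj xs].
  - by rewrite mul0r addr0.
  - by rewrite (_ : p - n%:Z + s.+1%:Z * n%:Z = p + s%:Z * n%:Z); [apply: Kp|lia].
  - by rewrite (_ : p - n%:Z + j.+1%:Z * n%:Z = p + j%:Z * n%:Z); last lia.
  have [sj'|js] := ltnP s j; first by apply: (Dpos s) => //; lia.
  case: s sj js xs => [|s] sj js xs; first lia.
  by apply: (Dpos s); lia.
have [[x [gxp Kx [s sj nKx]]]|nbad] := classic (exists x, [/\ g < x < p, K (x - n%:Z)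
      & exists2 s, (s <= j)%N & ~ K (x + s%:Z * n%:Z)]); last first.
  exists p, g, j; split=> // x gxp Kx s sj; apply: NNPP => nKx; apply: nbad; exists x.
  by split=> //; exists s.
(* x + J n is the first gap of its runner from x on. If J = 0, x replaces g; otherwise x replaces p,
   with J beads to move. *)
have [J [Jj nKJ KJ]] : exists J, [/\ (J <= j)%N, ~ K (x + J%:Z * n%:Z) &
    forall s, (s < J)%N -> K (x + s%:Z * n%:Z)].
  elim: s {-2}s (leqnn s) sj nKx => [|b IHb] s sb sj nKx.
    by exists 0%N; split=> //; move: nKx; have -> : s = 0%N by lia.
  have [[s' s's nKs']|all] := classic (exists2 s', (s' < s)%N & ~ K (x + s'%:Z * n%:Z)).
    by apply: (IHb s') => //; lia.
  by exists s; split=> // s' s's; apply: NNPP => nKs'; apply: all; exists s'.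
case: J Jj nKJ KJ => [|J] Jj nKJ KJ.
  apply: (IH p x j); first lia.
  split=> //; last by move=> s' y s'j ys; apply: (Dpos s') => //; lia.
  by split=> //; [lia|move: nKJ; rewrite mul0r addr0].
apply: (IH x g J.+1); first lia.
split=> //; first by split=> //; lia.
by move=> s' y s'j ys; apply: (Dpos s'); lia.
Qed.

End Profiles.

(** The beads decrease, so the first row with bead below x is the number of beads from x on; row
    size s + |x| + 1 already qualifies. *)
Definition bead_count (s : seq nat) (x : int) : nat :=
  find (fun r => bead s r < x) (iota 0 (size s + absz x).+2).

Section BeadCount.

Variable s : seq nat.
Hypothesis ps : is_partition s.

Lemma bead_countP x r : (r < bead_count s x)%N = (x <= bead s r).
Proof.
rewrite /bead_count; set M := (size s + absz x).+2; set P := fun r => _.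
have hP : has P (iota 0 M).
  apply/hasP; exists (size s + absz x).+1; first by rewrite mem_iota add0n /M ltnSn.
  by rewrite /P /bead nth_default; lia.
have fM : (find P (iota 0 M) < M)%N by have := hP; rewrite has_find size_iota.
have Pf : bead s (find P (iota 0 M)) < x.
  by have := nth_find 0%N hP; rewrite nth_iota.
case: (leqP (find P (iota 0 M)) r) => fr.
  apply/esym/negbTE; rewrite -ltNge; apply: le_lt_trans Pf.
  move: fr; rewrite leq_eqVlt => /orP[/eqP<- //|lt].
  by apply: ltW; rewrite bead_lt.
have := before_find 0%N fr; rewrite nth_iota ?add0n /P; last exact: ltn_trans fM.
by move=> /negbT; rewrite -leNgt => ->.
Qed.

Lemma bead_count_step (x : int) :
  (bead_count s (x + 1))%:Z <= (bead_count s x)%:Z <= (bead_count s (x + 1))%:Z + 1.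
Proof.
set u := bead_count s x; set v := bead_count s (x + 1).
have e1 := bead_countP x; have e2 := bead_countP (x + 1).
apply/andP; split.
  rewrite lez_nat leqNgt; apply/negP => uv.
  by have := e1 u; have := e2 u; rewrite -/u -/v uv ltnn; lia.
rewrite leNgt; apply/negP => vu.
have := e1 v; have := e1 v.+1; have := e2 v; have := bead_lt v v.+1 ps.
by rewrite -/u -/v ltnn ltnSn; lia.
Qed.

Lemma bead_count_anti x y : x <= y -> (bead_count s y <= bead_count s x)%N.
Proof.
move=> xy; rewrite leqNgt; apply/negP => lt; have := bead_countP x (bead_count s x).
by have := bead_countP y (bead_count s x); rewrite lt ltnn; lia.
Qed.

Lemma bead_row r : bead_count s (bead s r + 1) = r /\ bead_count s (bead s r) = r.+1.
Proof.
have H x n : (forall r', (r' < n)%N = (x <= bead s r')) -> bead_count s x = n.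
  move=> Hn; apply/eqP; rewrite eqn_leq leqNgt bead_countP -Hn ltnn /=.
  by rewrite leqNgt Hn -bead_countP ltnn.
split; apply: H => r'; have := bead_lt r' r ps; have := bead_lt r r' ps.
  by case: (ltngtP r r') => [||->]; lia.
by case: (ltngtP r r') => [||->]; lia.
Qed.

Lemma row_of_bead (x : int) : (bead_count s x)%:Z = (bead_count s (x + 1))%:Z + 1 ->
  bead s (bead_count s (x + 1)) = x.
Proof.
have := bead_countP x (bead_count s (x + 1)); have := bead_countP (x + 1) (bead_count s (x + 1)).
by rewrite ltnn; lia.
Qed.

Lemma bead_has_row r : (bead_count s (bead s r))%:Z = (bead_count s (bead s r + 1))%:Z + 1.
Proof. by have [-> ->] := bead_row r; lia. Qed.

Lemma bead_count_high x : bead s 0 < x -> bead_count s x = 0%N.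
Proof. by move=> lt; apply/eqP; rewrite -leqn0 leqNgt bead_countP -ltNge. Qed.

Lemma bead_count_low x : x <= - (size s)%:Z -> (bead_count s x)%:Z = 1 - x.
Proof.
move=> le; have e : bead s (absz x) = x by rewrite /bead nth_default; lia.
by have [_] := bead_row (absz x); rewrite e; lia.
Qed.

End BeadCount.

Lemma bead_count_core k s (x : int) : is_core k s ->
  (bead_count s x)%:Z - (bead_count s (x + 1))%:Z <=
  (bead_count s (x - k.+1%:Z))%:Z - (bead_count s (x - k.+1%:Z + 1))%:Z.
Proof.
move=> cs; have ps : is_partition s by case: cs.
have := bead_count_step ps x; have := bead_count_step ps (x - k.+1%:Z).
have [e _ _|ne] := eqVneq ((bead_count s x)%:Z) ((bead_count s (x + 1))%:Z + 1); last lia.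
have bE := bead_bounce cs (bead_count s (x + 1)); rewrite (row_of_bead ps e) in bE.
by have := bead_has_row ps (bounce k (part_of k s) (bead_count s (x + 1))); rewrite bE e; lia.
Qed.

Section CoverBetween.

Variables (k : nat) (s t : seq nat).
Hypothesis cs : is_core k s.
Hypothesis ct : is_core k t.
Hypothesis sub : forall r, bead t r <= bead s r.
Local Notation n := k.+1.
Local Notation d := (bounce k (part_of k s)).
Local Notation b := (bead s).
Local Notation N x := ((bead_count s x)%:Z).
Local Notation K x := (N x = N (x + 1) + 1).
Let ps : is_partition s. Proof. by case: cs. Qed.
Let pt : is_partition t. Proof. by case: ct. Qed.
Let dgt : forall r, (r < d r)%N := bounce_gt (core_part_le cs).
Let dmono : {mono d : r r' / (r < r')%N} :=
  bounce_mono (core_part_le cs) (core_part_noninc cs).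
Let bd r : b (d r) = b r - n%:Z := bead_bounce cs r.

Let Kdown (x : int) m : K x -> K (x - m%:Z * n%:Z).
Proof.
exact: (@profile_bead_down n (fun x => N x) (ltn0Sn k) (bead_count_step ps) (fun x => bead_count_core x cs) x m).
Qed.

Let leN x : (bead_count t x)%:Z <= N x.
Proof.
rewrite lez_nat leqNgt; apply/negP => lt.
have := bead_countP pt x (bead_count s x); have := bead_countP ps x (bead_count s x).
by have := sub (bead_count s x); rewrite lt ltnn; lia.
Qed.

Let d_shift r m : (d r + m <= d (r + m))%N.
Proof.
elim: m => [|m IH]; first by rewrite !addn0.
by rewrite !addnS; apply: leq_ltn_trans IH _; rewrite dmono.
Qed.

(** T is the row of the highest moving bead, a = j - 1, and h counts the beads in (g - n, p - n]. By
    minimality the windows (g + i n, p + i n] with -1 <= i <= a carry the same bead pattern, which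
    gives the ladder. *)
Lemma cover_of_candidate p g j :
  candidate n (fun x => N x) (fun x => (bead_count t x)%:Z) p g j -> p - n%:Z < g ->
  (forall x : int, g < x < p -> K (x - n%:Z) -> forall i, (i <= j)%N -> K (x + i%:Z * n%:Z)) ->
  exists T a h, cover_data d T a h /\ forall r, bead t r <= cover_bead k s T a h r.
Proof.
case=> j0 Kp nKp [gp nKg Kg] Dpos pg all.
pose a := j.-1; have aj : a.+1 = j by rewrite /a; lia.
pose T := bead_count s (p + a%:Z * n%:Z + 1).
pose z i := iter i d T.
have bT : b T = p + a%:Z * n%:Z by apply: row_of_bead => //; apply: Kp; lia.
have bz i : b (z i) = p + a%:Z * n%:Z - i%:Z * n%:Z.
  elim: i => [|i IH]; first by rewrite mul0r subr0.
  by rewrite /z iterS bd -/(z i) IH; lia.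
have zE i : bead_count s (p + a%:Z * n%:Z - i%:Z * n%:Z + 1) = z i.
  by rewrite -bz; have [] := bead_row ps (z i).
pose h := (bead_count s (g - n%:Z + 1) - z a.+1)%N.
have za1 : z a.+1 = bead_count s (p - n%:Z + 1).
  by rewrite -zE; congr bead_count; lia.
have Kp0 : K p by have := Kp 0%N j0; rewrite mul0r addr0.
have tele i m : (i <= a)%N -> g + m%:Z <= p ->
   N (p - m%:Z + i%:Z * n%:Z + 1) - N (p + i%:Z * n%:Z + 1)
   = N (p - m%:Z - n%:Z + 1) - N (p - n%:Z + 1).
  move=> ia; elim: m => [|m IH] mp; first by rewrite !subr0 !subrr.
  have {}IH := IH ltac:(lia).
  pose x := p - m%:Z.
  have e1 : K (x + i%:Z * n%:Z) <-> K (x - n%:Z).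
    split=> Kx.
      have := Kdown i.+1 Kx; rewrite (_ : x + i%:Z * n%:Z - i.+1%:Z * n%:Z = x - n%:Z) //; lia.
    have [e|ne] := eqVneq m 0%N.
      by have := Kp i; rewrite /x e subr0; apply; lia.
    by apply: all Kx _ _; rewrite /x; lia.
  have := bead_count_step ps (x + i%:Z * n%:Z); have := bead_count_step ps (x - n%:Z).
  move: IH e1; rewrite -/x.
  have -> : p - m.+1%:Z + i%:Z * n%:Z + 1 = x + i%:Z * n%:Z by rewrite /x; lia.
  have -> : p - m.+1%:Z - n%:Z + 1 = x - n%:Z by rewrite /x; lia.
  lia.
have h_pos : (z a.+1 < bead_count s (g - n%:Z + 1))%N.
  have Kpn := Kdown 1 Kp0; rewrite mul1r in Kpn.
  by have := @bead_count_anti s ps (g - n%:Z + 1) (p - n%:Z); rewrite za1; lia.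
have gE i : (i <= a.+1)%N -> bead_count s (g + a%:Z * n%:Z - i%:Z * n%:Z + 1) = (z i + h)%N.
  rewrite leq_eqVlt => /orP[/eqP->|ia].
    have -> : g + a%:Z * n%:Z - a.+1%:Z * n%:Z + 1 = g - n%:Z + 1 by lia.
    by rewrite /h; lia.
  have := tele (a - i)%N `|p - g|%N (leq_subr _ _) ltac:(lia).
  have -> : p - `|p - g|%N%:Z = g by lia.
  have -> : g + (a - i)%N%:Z * n%:Z + 1 = g + a%:Z * n%:Z - i%:Z * n%:Z + 1.
    by rewrite -subzn //; lia.
  have -> : p + (a - i)%N%:Z * n%:Z + 1 = p + a%:Z * n%:Z - i%:Z * n%:Z + 1.
    by rewrite -subzn //; lia.
  by rewrite zE -za1 /h; lia.
have bg : b (z a.+1 + h)%N = g - n%:Z.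
  rewrite -gE // (_ : g + a%:Z * n%:Z - a.+1%:Z * n%:Z + 1 = g - n%:Z + 1); last lia.
  exact: row_of_bead.
have lad : ladder d T a h.
  split.
  - by rewrite /h subn_gt0.
  - move=> y yT; apply: nKp; have := bead_has_row ps y; have := bd y.
    by rewrite yT bT -aj => e; have -> : b y = p + a.+1%:Z * n%:Z by lia.
  - move=> i j' ia j'h; rewrite -/(z i) -/(z i.+1).
    (* d increases by at least one per row, and it sends the last row of block i before z_(i+1) + h;
       so it is a translation on the block. *)
    have e1 : (z i.+1 + j' <= d (z i + j'))%N by apply: d_shift.
    have e2 := d_shift (z i + j') (h.-1 - j').
    have e3 : (d (z i + h.-1) < z i.+1 + h)%N.
      rewrite -gE // bead_countP // bd.
      have : (z i + h.-1 < z i + h)%N by lia.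
      by rewrite -(gE i) ?(leqW ia) // bead_countP //; lia.
    by move: e2; rewrite -addnA subnKC; lia.
  - move=> j' /andP[j'0 j'h].
    have r1 : (T + j' < z 0 + h)%N by rewrite ltn_add2l.
    rewrite -(gE 0%N) // mul0r subr0 bead_countP // in r1.
    have r2 : b (T + j')%N < b T by rewrite bead_lt //; lia.
    pose x := b (T + j')%N - a%:Z * n%:Z.
    have Kx : K (x - n%:Z).
      have := Kdown a.+1 (bead_has_row ps (T + j')%N).
      by rewrite (_ : b (T + j')%N - a.+1%:Z * n%:Z = x - n%:Z) // /x; lia.
    have := all x _ Kx j (leqnn j); rewrite /x => /(_ ltac:(lia)).
    have -> : b (T + j')%N - a%:Z * n%:Z + j%:Z * n%:Z = b (T + j')%N + n%:Z.
      by rewrite -aj; lia.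
    move=> /(row_of_bead ps) e.
    exists (bead_count s (b (T + j')%N + n%:Z + 1)); apply: (bead_inj ps).
    by rewrite bd e; lia.
  rewrite -/(z a) -/(z a.+1) -gE // za1.
  by apply: bead_count_anti => //; lia.
have cov : cover_data d T a h.
  split=> // y yE; apply: nKg; have := bead_has_row ps y; have := bd y.
  by rewrite yE -/(z a.+1) bg => e; have -> : b y = g by lia.
exists T, a, h; split=> // r.
case: (boolP (in_block k s T a h r)) => [/(in_blockP cov)[i [j' [ia j'h rE]]]|nb]; last first.
  by rewrite (cover_bead_out cov).
(* Throughout these windows t has fewer beads from x on than s, which pushes each row of t in the
   block below the shifted bead. *)
have Dp x : g + a%:Z * n%:Z - i%:Z * n%:Z < x <= p + a%:Z * n%:Z - i%:Z * n%:Z ->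
    N x > (bead_count t x)%:Z.
  move=> xb; rewrite -subr_gt0; apply: (Dpos (a - i)%N); first lia.
  by rewrite -subzn //; lia.
rewrite rE (cover_bead_block cs cov) // -rE leNgt; apply/negP => lt.
have bzi := bz i; rewrite /z in bzi.
have brz : b r <= b (iter i d T) by rewrite leNgt bead_lt // rE; lia.
move: lt; case: eqP => [jE|jE] lt.
  have sh : cover_shift k s T a h = p - g.
    by rewrite /cover_shift -/(z a.+1) bg bz; lia.
  have := Dp (g + a%:Z * n%:Z - i%:Z * n%:Z + 1).
  have := bead_countP pt (g + a%:Z * n%:Z - i%:Z * n%:Z + 1) r.
  rewrite gE ?(leqW ia) //; rewrite /z -jE; lia.
have := Dp (b r.+1 + 1).
have r1 : (r.+1 < z i + h)%N by rewrite rE /z; lia.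
rewrite -gE ?(leqW ia) // bead_countP // in r1.
have := bead_countP pt (b r.+1 + 1) r; have := bead_countP ps (b r.+1 + 1) r.+1.
by have := bead_lt r r.+1 ps; rewrite ltnSn; lia.
Qed.

End CoverBetween.

Lemma cover_between k s t : is_core k s -> is_core k t ->
  (forall r, bead t r <= bead s r) -> t <> s ->
  exists T a h, cover_data (bounce k (part_of k s)) T a h /\
                forall r, bead t r <= cover_bead k s T a h r.
Proof.
move=> cs ct sub ts; have ps : is_partition s by case: cs.
have pt : is_partition t by case: ct.
have [r lt] : exists r, bead t r < bead s r.
  apply: NNPP => nex; apply: ts; apply: partition_ext => // r.
  have : ~ bead t r < bead s r by move=> lt; apply: nex; exists r.
  by have := sub r; rewrite /bead; lia.
pose Hi := 1 + Num.max (bead s 0) (bead t 0).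
pose Lo := - (size s + size t)%N%:Z - 1.
have leN (x : int) : (bead_count t x)%:Z <= (bead_count s x)%:Z.
  rewrite lez_nat leqNgt; apply/negP => lt'.
  have := bead_countP pt x (bead_count s x); have := bead_countP ps x (bead_count s x).
  by have := sub (bead_count s x); rewrite lt' ltnn; lia.
have [||| p [g [j cand]]] := @candidate_ex k.+1 (fun x => (bead_count s x)%:Z)
  (fun x => (bead_count t x)%:Z) isT (bead_count_step ps) (bead_count_step pt)
  (fun x => bead_count_core x cs) (fun x => bead_count_core x ct) leN (bead s r) Hi Lo.
- have [_ ->] := bead_row ps r; have := bead_countP pt (bead s r) r.
  by rewrite [_ <= _]leNgt lt /=; lia.
- by move=> x Hx; rewrite !bead_count_high //; rewrite /Hi in Hx; lia.
- move=> x xLo; rewrite /Lo in xLo; rewrite !bead_count_low //; lia.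
have [p' [g' [j' [cand' pg all]]]] := candidate_min (ltn0Sn k) (bead_count_step ps)
   (fun x => bead_count_core x cs) cand.
exact: cover_of_candidate cand' pg all.
Qed.

(** A slide of s that still contains t loses exactly one unit; iterate until t is reached. *)
Lemma core_size_lt k s t : is_core k s -> is_core k t ->
  (forall r, bead t r <= bead s r) -> t <> s ->
  (sumn (core_part k t) < sumn (core_part k s))%N.
Proof.
have [m] := ubnP (sumn (core_part k s)); elim: m s => // m IH s; rewrite ltnS => sm cs ct sub ts.
have [T [a [h [cov le]]]] := cover_between cs ct sub ts.
have [u cu [uE uw]] := cover_core cs cov; have us := cover_size cs cov cu uw.
have [->|tu] := classic (t = u); first by lia.
have := IH u _ cu ct _ tu; rewrite -us addn1 => H.
by apply: leqW; apply: H => [|r]; [lia|rewrite uE].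
Qed.

(** The slide u found between t and s has the same size as t, so strict monotonicity forces u =
    t. *)
Lemma strong_coverP k t s : is_core k s ->
  strong_cover k t s <-> is_core k t /\
  exists T a h, cover_data (bounce k (part_of k s)) T a h /\
                forall r, bead t r = cover_bead k s T a h r.
Proof.
move=> cs; split=> [[ct _ sub size1]|[ct [T [a [h [cov tE]]]]]].
  split=> //; have sub' r : bead t r <= bead s r by have := sub r; rewrite /bead; lia.
  have ts : t <> s by move=> e; move: size1; rewrite e; lia.
  have [T [a [h [cov le]]]] := cover_between cs ct sub' ts.
  have [u cu [uE uw]] := cover_core cs cov; have us := cover_size cs cov cu uw.
  exists T, a, h; split=> // r; rewrite -uE; congr bead; apply: NNPP => tu.
  have : (sumn (core_part k t) < sumn (core_part k u))%N.
    by apply: core_size_lt => // r'; rewrite uE.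
  by lia.
have [u cu [uE uw]] := cover_core cs cov; have us := cover_size cs cov cu uw.
have tu : t = u.
  apply: partition_ext; [by case: ct|by case: cu|move=> r].
  by have := tE r; rewrite -uE /bead; lia.
split=> // [r|]; last by rewrite tu.
have [le _] := cover_bead_le cs cov r.
by move: le; rewrite -tE /bead; lia.
Qed.

(** * Matching covers with straightened terms *)

Lemma finite_choice (A : eqType) (B : Type) (b0 : B) (P : A -> B -> Prop) (Z : seq A) :
  (forall q, q \in Z -> exists b, P q b) -> exists f, forall q, q \in Z -> P q (f q).
Proof.
elim: Z => [|q0 Z IH] ex; first by exists (fun=> b0).
have [|f fP] := IH; first by move=> q qZ; apply: ex; rewrite in_cons qZ orbT.
have [b bP] := ex q0 (mem_head _ _); exists (fun q => if q == q0 then b else f q).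
by move=> q; rewrite in_cons; case: eqVneq => [->|_] //=; apply: fP.
Qed.

Lemma kschur_kcat k mu ell (g : nat -> int) D :
  (forall r, (nth 0%N mu r)%:Z = g r) -> (forall r, (ell <= r)%N -> g r = 0) ->
  kschur k mu D = kcat k ell g D.
Proof.
move=> mug g0; rewrite -[LHS]/(kcat k (size mu) (fun r => (nth 0%N mu r)%:Z) D).
rewrite (eq_kcat _ (fun r _ => mug r)).
rewrite -(kcat_pads _ _ (leq_maxl (size mu) ell)) => [|r mur]; last by rewrite -mug nth_default.
by rewrite (kcat_pads _ _ (leq_maxr (size mu) ell)).
Qed.

Section CoverComponents.

Variables (k : nat) (s t : seq nat) (T a h : nat).
Hypothesis cs : is_core k s.
Hypothesis ct : is_core k t.
Local Notation d := (bounce k (part_of k s)).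
Hypothesis cov : cover_data d T a h.
Hypothesis tE : forall r, bead t r = cover_bead k s T a h r.
Local Notation z i := (iter i d T).
Let ps : is_partition s. Proof. by case: cs. Qed.
Let pt : is_partition t. Proof. by case: ct. Qed.

Let h_gt0 : (0 < h)%N. Proof. by case: cov => [[]]. Qed.

Let rows r : (nth 0 t r < nth 0 s r)%N <->
  exists i j, [/\ (i <= a)%N, (j < h)%N & r = (z i + j)%N].
Proof.
have := cover_bead_le cs cov r; rewrite -tE => -[le eq].
split=> [lt|]; last first.
  by move/(in_blockP cov) => inb; move: eq; rewrite inb /bead; move: le; rewrite /bead; case: eqP; lia.
apply/(in_blockP cov); apply: contraLR lt => nb; move: eq; rewrite nb /bead; lia.
Qed.

Let links r : (nth 0 t r < nth 0 s r.+1)%N <->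
  exists i j, [/\ (i <= a)%N, (j.+1 < h)%N & r = (z i + j)%N].
Proof.
have -> : (nth 0 t r < nth 0 s r.+1)%N = (bead t r <= bead s r.+1) by rewrite /bead; lia.
rewrite tE (cover_bead_link cs cov); split=> [/andP[/(in_blockP cov)[i [j [ia jh ->]]]]|].
  by rewrite (block_endE cs cov) // => jh'; exists i, j; split=> //; lia.
move=> [i [j [ia jh ->]]]; rewrite (block_endE cs cov) ?(ltnW jh) //.
apply/andP; split; last by lia.
by apply/(in_blockP cov); exists i, j; split=> //; apply: ltnW.
Qed.

Let gaps i i' : (i < i')%N -> (i' <= a)%N -> (z i + h <= z i')%N.
Proof. by move=> ii' i'a; apply: (block_lt cs cov) => //; apply: leqW. Qed.

Let t_anti r r' := @partition_nth_le t r r' pt.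
Let s_anti r r' := @partition_nth_le s r r' ps.

Lemma cover_marks m :
  (exists2 C, C \in components t s & is_top_row m C) <-> exists2 i, (i <= a)%N & m = z i.
Proof. exact: (top_rowP h_gt0 t_anti s_anti rows links gaps). Qed.

Lemma cover_spin_eq q : (q <= a)%N -> cover_spin t s (z q) = (a - q + a.+1 * h.-1)%N.
Proof. exact: (cover_spinE h_gt0 t_anti s_anti rows links gaps). Qed.

End CoverComponents.

Section Assembly.

Variables (k ell : nat) (s : seq nat).
Hypothesis cs : is_core k s.
Local Notation l := (part_of k s).
Local Notation d := (bounce k l).
Hypothesis supp : forall r, (ell <= r)%N -> l r = 0%N.
Let lk := core_part_le cs.
Let ln := core_part_noninc cs.
Let dgt := bounce_gt lk.
Let dmono := bounce_mono lk ln.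

Let iter_inj i x y : iter i d x = iter i d y -> x = y.
Proof. by elim: i => //= i IH /(lt_mono_inj dmono)/IH. Qed.

Lemma cover_data_mark T a h m r : cover_data d T a h -> iter a d T = iter r d m ->
  (r <= a)%N /\ m = iter (a - r) d T.
Proof.
move=> [[_ nT _ _ _] _] e; have [ra|ar] := leqP r a.
  by split=> //; move: e; rewrite -{1}(subnKC ra) iterD => /iter_inj.
move: e; rewrite -(subnKC (ltnW ar)) iterD => /iter_inj; rewrite -(prednK (n := r - a)%N) ?subn_gt0 //=.
by move=> e; case: (nT _ (esym e)).
Qed.

Lemma cover_data_lt T a h : cover_data d T a h -> (iter a d T < ell)%N.
Proof.
move=> [_ lst]; rewrite ltnNge; apply/negP => le; apply: (lst (iter a d T + h)%N).
rewrite iterS /bounce !supp //; last exact: leq_trans le (leq_addr _ _).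
lia.
Qed.

Lemma cover_injective T a h T' a' h' r r' m :
  cover_data d T a h -> cover_data d T' a' h' ->
  iter a d T = iter r d m -> iter a' d T' = iter r' d m ->
  (forall x, cover_bead k s T a h x = cover_bead k s T' a' h' x) ->
  (r, T, a, h) = (r', T', a', h').
Proof.
(* If r1 < r2, the second slide moves the bead of row d^(r2)(m), which lies below every row touched
   by the first. *)
have lt_absurd T1 a1 h1 T2 a2 h2 r1 r2 : cover_data d T1 a1 h1 -> cover_data d T2 a2 h2 ->
    iter a1 d T1 = iter r1 d m -> iter a2 d T2 = iter r2 d m -> (r1 < r2)%N ->
    (forall x, cover_bead k s T1 a1 h1 x = cover_bead k s T2 a2 h2 x) -> False.
  move=> c1 c2 e1 e2 lt eq.
  have z12 : (iter a1.+1 d T1 <= iter a2 d T2)%N.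
    rewrite iterS e1 -iterS e2 -[X in (_ <= iter X _ _)%N](subnK lt) iterD.
    by apply: leq_trans (leq_iter dgt _ _); rewrite leq_addr.
  have room : (iter a1 d T1 + h1 <= iter a1.+1 d T1)%N by case: c1 => [[]].
  have := eq (iter a2 d T2); rewrite (cover_bead_out c1).
    have [_] := cover_bead_le cs c2 (iter a2 d T2); move=> e3 e4.
    move: e3; rewrite e4 eqxx => /esym/negP; apply; apply/(in_blockP c2).
    by exists a2, 0%N; rewrite addn0; case: c2 => [[]].
  apply/(in_blockP c1) => -[i [j [ia jh zE]]].
  have : (iter i d T1 <= iter a1 d T1)%N.
    rewrite -(subnK ia) iterD; apply: leq_trans (leq_iter dgt _ _); exact: leq_addr.
  by lia.
move=> c1 c2 e1 e2 eq.
have [lt|lt|rr'] := ltngtP r r'.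
- by case: (lt_absurd _ _ _ _ _ _ _ _ c1 c2 e1 e2 lt eq).
- by case: (lt_absurd _ _ _ _ _ _ _ _ c2 c1 e2 e1 lt (fun x => esym (eq x))).
have n1 : forall y, d y <> T by case: c1 => [[]].
have n2 : forall y, d y <> T' by case: c2 => [[]].
have [TT aa] := chain_top_unique dmono n1 n2 (etrans e1 (etrans (congr1 (fun i => iter i d m) rr') (esym e2))).
by move: c1; rewrite TT aa rr' => c1; rewrite (cover_data_height c1 c2).
Qed.

End Assembly.

Theorem theorem9p2 (k ell : nat) (hk : (0 < k)%N) (hell : (0 < ell)%N)
    (lam : 'rV[int]_ell) (hlam : in_Par k lam) (m : 'I_ell) :
  exists Ts : {fset marked_pair},
    (forall T : marked_pair,
       T \in Ts <-> in_VSMT1 k lam T /\ marks T = [fset (m : nat)]%fset) /\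
    (forall d : nat,
       catalan (Delta k lam) (lam - eps m) d =
       \sum_(T <- Ts) tpow_mul (spin T) (kschur k (inside k T)) d).
Proof.
have [lam_bd lam_mono] := hlam.
pose l0 r : nat := if insub r is Some i then absz (lam 0 (i : 'I_ell)) else 0%N.
have l0E (i : 'I_ell) : (l0 i)%:Z = lam 0 i.
  by rewrite /l0 valK; have := lam_bd i; lia.
have l0supp r : (ell <= r)%N -> l0 r = 0%N by move=> lr; rewrite /l0 insubF // ltnNge lr.
have l0lt r (rl : (r < ell)%N) : (l0 r)%:Z = lam 0 (Ordinal rl) := l0E (Ordinal rl).
have l0k r : (l0 r <= k)%N.
  case: (ltnP r ell) => [rl|/l0supp->//].
  by have := l0lt _ rl; have := lam_bd (Ordinal rl); lia.
have l0mono r r' : (r <= r')%N -> (l0 r' <= l0 r)%N.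
  move=> rr'; case: (ltnP r' ell) => [rl|/l0supp->//].
  have rl' := leq_ltn_trans rr' rl.
  by have := l0lt _ rl; have := l0lt _ rl'; have := lam_mono (Ordinal rl') (Ordinal rl) rr'; lia.
have padE mu : same_padding mu lam <-> forall r, nth 0%N mu r = l0 r.
  have e r : (if insub r is Some i then lam 0 (i : 'I_ell) else 0) = (l0 r)%:Z.
    rewrite /l0; case: insubP => [i _ _|_] //; by have := lam_bd i; lia.
  by split=> H r; have := H r; rewrite e; lia.
have [s cs sE] := core_of_part l0k l0mono l0supp.
have supp r : (ell <= r)%N -> part_of k s r = 0%N by move=> lr; rewrite sE l0supp.
have lamE : lam = \row_(i < ell) (part_of k s i)%:Z.
  by apply/rowP=> i; rewrite mxE sE l0E.
have [Z [uZ ZP ZE]] := lowered_catalan_expand (core_part_le cs) (core_part_noninc cs) supp (ltn_ord m).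
have [f fP] : exists f : nat * nat * nat * nat -> seq nat, forall q, q \in Z ->
    is_core k (f q) /\ (forall r, bead (f q) r = cover_bead k s q.1.1.2 q.1.2 q.2 r) /\
    (forall r, (part_of k (f q) r)%:Z = cover_weight k (part_of k s) q.1.1.2 q.1.2 q.2 r).
  apply: (finite_choice [::] (P := fun q u => is_core k u /\
    (forall r, bead u r = cover_bead k s q.1.1.2 q.1.2 q.2 r) /\
    (forall r, (part_of k u r)%:Z = cover_weight k (part_of k s) q.1.1.2 q.1.2 q.2 r))) => -[[[r T] a] h] /ZP[cov _ _].
  by have [u cu [uE uw]] := cover_core cs cov; exists u.
pose F q : marked_pair := (f q, s, m : nat).
have F_inj : {in Z &, injective F}.
  move=> [[[r T] a] h] [[[r' T'] a'] h'] qZ qZ' [ff].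
  have [c1 e1 _] := proj1 (ZP _ _ _ _) qZ; have [c2 e2 _] := proj1 (ZP _ _ _ _) qZ'.
  apply: (cover_injective cs c1 c2 e1 e2) => x.
  by have [_ [<- _]] := fP _ qZ; have [_ [<- _]] := fP _ qZ'; rewrite ff.
have uFZ : uniq (map F Z) by rewrite map_inj_in_uniq.
exists [fset T in map F Z]%fset; split=> [[[t s'] m']|D].
  rewrite inE /in_VSMT1 /strong_marked_cover /marks /smc_inner /smc_outer /smc_mark /=.
  split=> [/mapP[[[[r T] a] h] qZ [-> -> ->]]|[[[sc top] /padE pad] /fset1_inj mm]].
    have [cov e zl] := proj1 (ZP _ _ _ _) qZ; have [ct [tE tw]] := fP _ qZ.
    have [ra mE] := cover_data_mark cs cov e.
    split=> //; split; last by apply/padE.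
    split; first by apply/(strong_coverP _ cs); split=> //; exists T, a, h.
    by apply/(cover_marks cs ct cov tE); exists (a - r)%N; rewrite ?leq_subr.
  have cs' : is_core k s' by case: sc.
  have ss' : s' = s by apply: (core_part_inj cs' cs) => r; rewrite pad sE.
  subst s'; have /(strong_coverP _ cs) [ct [T [a [h [cov tE]]]]] := sc.
  have [i ia mE] := proj1 (cover_marks cs ct cov tE m') top.
  (* The mark is z_i, so the last row z_a is a - i steps away from it. *)
  pose q := ((a - i)%N, T, a, h).
  have qZ : q \in Z.
    apply/ZP; have e : iter a (bounce k (part_of k s)) T = iter (a - i) (bounce k (part_of k s)) m.
      by rewrite -mm mE -iterD subnK.
    by split=> //; rewrite -e; apply: (cover_data_lt supp cov).
  apply/mapP; exists q => //; rewrite /F -mm; congr (_, _, _).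
  have [cf [fE _]] := fP _ qZ.
  apply: partition_ext; [by case: ct|by case: cf|move=> r].
  by have := tE r; rewrite -(fE r) /bead; lia.
have -> : catalan (Delta k lam) (lam - eps m) D = lowered_catalan k ell (part_of k s) m D.
  rewrite /lowered_catalan -lamE.
  have -> // : lam - eps m = \row_(i < ell) ((part_of k s i)%:Z - (i == m :> nat)%:R).
  by apply/rowP=> i; rewrite !mxE sE l0E.
rewrite ZE (perm_big (map F Z)) /=; last first.
  by apply: uniq_perm => [||x]; [exact: fset_uniq|exact: uFZ|rewrite inE].
rewrite big_map big_seq [RHS]big_seq; apply: eq_bigr => -[[[r T] a] h] qZ.
have [cov e zl] := proj1 (ZP _ _ _ _) qZ; have [ct [tE tw]] := fP _ qZ.
have [ra mE] := cover_data_mark cs cov e.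
have -> : spin (F (r, T, a, h)) = (r + a.+1 * h.-1)%N.
  rewrite /spin /F /smc_inner /smc_outer /smc_mark /= mE.
  by rewrite (cover_spin_eq cs ct cov tE) ?leq_subr // subKn.
rewrite /tpow_mul; case: ifP => // _; apply/esym; apply: kschur_kcat => // x lx.
have := tw x; have room := ladder_room (bounce_gt (core_part_le cs)) cov.1 (leq0n a).
rewrite /cover_weight /= supp //.
(* If d(x) < T + h <= d(T), then x < T <= z_a < ell, against x >= ell. *)
have -> : (T < bounce k (part_of k s) x < T + h)%N = false.
  apply/negP => /andP[_ lt]; have := leq_trans lt room; rewrite /=.
  rewrite bounce_mono => [xT|y|y y']; [|exact: core_part_le|exact: core_part_noninc].
  have := leq_iter (bounce_gt (core_part_le cs)) a T; rewrite e; lia.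
by rewrite /=; lia.
Qed.
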